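(* Let $\sharp\in\{cy,ra\}$ and assume (ER$\sharp$). 1) For every initial state $\rho$ of $\mathcal S$ and all $\alpha,\boldsymbol\zeta\in\mathbb R^M$, $r^\sharp_{\boldsymbol\zeta}(\alpha)=\lim_{n\to\infty}r^\sharp_{n,\rho}(\alpha)^{1/n}$. 2) If (TRI) holds, then $r^{cy}_{\boldsymbol\zeta}(\mathbf 1-\alpha)=r^{rcy}_{\boldsymbol\zeta}(\alpha)$ and $r^{ra}_{\boldsymbol\zeta}(\mathbf 1-\alpha)=r^{ra}_{\boldsymbol\zeta}(\alpha)$, where $\mathbf 1=(1,\dots,1)$. 3) If (NE) holds, then $r^\sharp_{\boldsymbol\zeta}(\alpha)=r^\sharp_{\boldsymbol\zeta}(\alpha+\lambda\beta^{-1})$ for all $\alpha,\boldsymbol\zeta\in\mathbb R^M$ and $\lambda\in\mathbb R$, where $\beta^{-1}=(\beta_1^{-1},\dots,\beta_M^{-1})$.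
   Context: Setting: finite-dimensional $\mathcal H_{\mathcal S}$, $\mathcal H_{\mathcal E_j}$ ($j=1,\dots,M$, $M\ge2$), self-adjoint $H_{\mathcal S},H_{\mathcal E_j}$, self-adjoint $V_j$ on $\mathcal H_{\mathcal S}\otimes\mathcal H_{\mathcal E_j}$, $\tau_j>0$, $H_j=H_{\mathcal S}\otimes\mathrm{Id}+\mathrm{Id}\otimes H_{\mathcal E_j}+V_j$, $U_j=e^{-i\tau_jH_j}$. Fix $\beta_{\rm ref}>0$; for $\boldsymbol\zeta\in\mathbb R^M$, $\beta_j=\beta_{\rm ref}-\zeta_j$, $\rho_{\mathcal E_j}=e^{-\beta_jH_{\mathcal E_j}}/\mathrm{Tr}(e^{-\beta_jH_{\mathcal E_j}})$; $\mathcal L_j(\rho)=\mathrm{Tr}_{\mathcal H_{\mathcal E_j}}(U_j(\rho\otimes\rho_{\mathcal E_j})U_j^* )$, $\mathcal L_{cy}=\mathcal L_M\circ\cdots\circ\mathcal L_1$, $\mathcal L_{ra}=\frac1M\sum_j\mathcal L_j$. Primitive CP map: with Kraus operators $V_i$, for some $n$ the products $V_{i_1}\cdots V_{i_n}$ span all operators. (ER$\sharp$): $\mathcal L_{\sharp,\boldsymbol\zeta}$ is primitive for some $\boldsymbol\zeta$. (NE): there is $\zeta\mapsto\rho_{+,\zeta}$ (states on $\mathcal H_{\mathcal S}$) with $U_j(\rho_{+,\zeta}\otimes\rho_{\mathcal E_j,\zeta})U_j^*=\rho_{+,\zeta}\otimes\rho_{\mathcal E_j,\zeta}$ for all $j$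 and $\zeta\in\mathbb R$, $\rho_{\mathcal E_j,\zeta}$ being the Gibbs state of $H_{\mathcal E_j}$ at inverse temperature $\beta_{\rm ref}-\zeta$. (TRI): antiunitary involutions $\theta$ on $\mathcal H_{\mathcal S}$ and $\theta_{\mathcal E_j}$ on $\mathcal H_{\mathcal E_j}$ commuting with $H_{\mathcal S}$, resp. $H_{\mathcal E_j}$, such that $\theta\otimes\theta_{\mathcal E_j}$ commutes with $V_j$. Deformed maps: for $\alpha\in\mathbb C^M$, $\mathcal L_j^{[\alpha]*}(X)=\mathrm{Tr}_{\mathcal H_{\mathcal E_j}}\big((\mathrm{Id}\otimes\rho_{\mathcal E_j}^{1-\alpha_j})U_j^*(X\otimes\rho_{\mathcal E_j}^{\alpha_j})U_j\big)$, $\mathcal L_{cy}^{[\alpha]*}=\mathcal L_1^{[\alpha]*}\circ\cdots\circ\mathcal L_M^{[\alpha]*}$, $\mathcal L_{rcy}^{[\alpha]*}=\mathcal L_M^{[\alpha]*}\circ\cdots\circ\mathcal L_1^{[\alpha]*}$, $\mathcal L_{ra}^{[\alpha]*}=\frac1M\sum_j\mathcal L_j^{[\alpha]*}$; $r^\sharp_{\boldsymbol\zeta}(\alpha)$ ($\sharp\in\{cy,rcy,ra\}$) is the spectral radius of $\mathcal L^{[\alpha]*}_{\sharp,\boldsymbol\zeta}$. Full counting statistics: for $\mathbf j=(j_n)\in\{1,\dots,M\}^{\mathbb N^*}$, $N\ge1$ and an initial state $\rho$, take probes $\mathcal E^n$ (copies of $\mathcal E_{j_n}$), $U_n$ the copy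 of $U_{j_n}$ on $\mathcal H_{\mathcal S}\otimes\mathcal H_{\mathcal E^n}$, $S^n=\beta_{j_n}H_{\mathcal E^n}$, $\rho^N_{tot}=\rho\otimes\rho_{\mathcal E^1}\otimes\cdots\otimes\rho_{\mathcal E^N}$. For $\mathbf s=((s_n,s'_n))_{n\le N}$, $s_n,s'_n\in\mathrm{sp}(S^n)$, let $\mathcal U^{\mathbf s}_N=\Pi_{s'_N}(S^N)U_N\Pi_{s_N}(S^N)\cdots\Pi_{s'_1}(S^1)U_1\Pi_{s_1}(S^1)$ ($\Pi_s$ spectral projections) and $\mathbb P_{\mathbf j}(\mathbf s)=\mathrm{Tr}(\mathcal U^{\mathbf s}_N\rho^N_{tot}\mathcal U^{\mathbf s*}_N)$. Entropy increments $\mathcal S^N_{\mathcal R_j}(\mathbf j)=\sum_{n\le N,\,j_n=j}(s'_n-s_n)$; $r^{\mathbf j}_{N,\rho}(\alpha)=\mathbb E_{\mathbb P_{\mathbf j}}\big(e^{-\sum_j\alpha_j\mathcal S^N_{\mathcal R_j}(\mathbf j)}\big)$. Cyclic: $\mathbf j^{cy}$ with $j^{cy}_{k+nM}=k$ and $r^{cy}_{N,\rho}(\alpha)=r^{\mathbf j^{cy}}_{NM,\rho}(\alpha)$ (MGF after $N$ cycles). Random: $\mathcal P$ is the product of uniform measures on $\{1,\dots,M\}^{\mathbb N^*}$ and $r^{ra}_{N,\rho}(\alpha)=\mathbb E_{\mathcal P}(r^{\mathbf j}_{N,\rho}(\alpha))$. *)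

(* Defs.v *)
From HB Require Import structures.
From mathcomp Require Import all_boot all_order all_algebra.
From mathcomp Require Import all_classical all_reals all_analysis.
From mathcomp Require Import complex mxtens.

Set Implicit Arguments.
Unset Strict Implicit.
Unset Printing Implicit Defensive.

Import Order.TTheory GRing.Theory Num.Theory.
Import numFieldNormedType.Exports.
Local Open Scope complex_scope.
Local Open Scope ring_scope.
Local Open Scope classical_set_scope.

Section Generic.
Variable R : realType.
Local Notation C := R[i].

Definition cexp (z : C) : C :=
  (expR (complex.Re z))%:C * Complex (cos (complex.Im z)) (sin (complex.Im z)).

(* x^a := e^{a ln x}, for x a positive real number (stored in C) *)
Definition cpow (x a : C) : C := cexp (a * (ln (complex.Re x))%:C).

Definition cvec (M : nat) (a : 'I_M -> R) : 'I_M -> C := fun j => (a j)%:C.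

Definition mxadj m n (A : 'M[C]_(m, n)) : 'M[C]_(n, m) := (map_mx conjc A)^T.

Definition selfadjoint n (A : 'M[C]_n) : Prop := mxadj A = A.
Definition unitarymatrix n (U : 'M[C]_n) : Prop := U *m mxadj U = 1%:M.

Definition psd n (A : 'M[C]_n) : Prop :=
  selfadjoint A /\ forall v : 'cV[C]_n, 0 <= (mxadj v *m A *m v) 0 0.
Definition is_state n (rho : 'M[C]_n) : Prop := psd rho /\ \tr rho = 1.

Definition spec n (A : 'M[C]_n) : seq C :=
  xget [::] [set s | uniq s /\ forall z, z \in s <-> eigenvalue A z].

(* spectral projection of a (diagonalizable, e.g. self-adjoint) matrix A
   on the eigenvalue l (Lagrange interpolation formula) *)
Definition specproj n (A : 'M[C]_n) (l : C) : 'M[C]_n :=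
  \prod_(m <- spec A | m != l) ((l - m)^-1 *: (A - m%:M)).

Definition mxfun n (f : C -> C) (A : 'M[C]_n) : 'M[C]_n :=
  \sum_(l <- spec A) f l *: specproj A l.

Definition mxpow n (A : 'M[C]_n) (a : C) : 'M[C]_n := mxfun (fun x => cpow x a) A.

Definition gibbs n (b : R) (H : 'M[C]_n) : 'M[C]_n :=
  let E := mxfun (fun x => cexp (- (b%:C) * x)) H in (\tr E)^-1 *: E.

(* partial trace over the second factor of H_1 (x) H_2 (Kronecker convention
   of mxtens.v: |a> (x) |b>  <->  index mxtens_index (a, b)) *)
Definition ptr (d1 d2 : nat) (A : 'M[C]_(d1 * d2)) : 'M[C]_d1 :=
  \matrix_(a, a') \sum_(b < d2) A (mxtens_index (a, b)) (mxtens_index (a', b)).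

Definition primitive n (L : 'M[C]_n -> 'M[C]_n) : Prop :=
  exists (k : nat) (K : 'I_k -> 'M[C]_n),
    (forall X, L X = \sum_(i < k) K i *m X *m mxadj (K i)) /\
    exists p : nat, forall Y : 'M[C]_n, exists c : p.-tuple 'I_k -> C,
      Y = \sum_(w : p.-tuple 'I_k) c w *: \prod_(i <- w) K i.

Definition specrad n (L : 'M[C]_n -> 'M[C]_n) : R :=
  sup [set Normc.normc z | z in [set z : C | exists X : 'M[C]_n, X != 0 /\ L X = z *: X]].

(* antiunitary maps on C^n, written theta = W o K with K the complex
   conjugation and W a unitarymatrix matrix *)
Definition antiop n (W : 'M[C]_n) (v : 'cV[C]_n) : 'cV[C]_n := W *m map_mx conjc v.
Definition antiunitary_involution n (W : 'M[C]_n) : Prop :=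
  unitarymatrix W /\ forall v, antiop W (antiop W v) = v.
Definition anticommutes n (W A : 'M[C]_n) : Prop :=
  forall v, antiop W (A *m v) = A *m antiop W v.

Definition op (T : finType) := T -> T -> C.
Definition omul (T : finType) (A B : op T) : op T := fun x y => \sum_(z : T) A x z * B z y.
Definition oadj (T : finType) (A : op T) : op T := fun x y => conjc (A y x).
Definition oid (T : finType) : op T := fun x y => (x == y)%:R.
Definition otr (T : finType) (A : op T) : C := \sum_(x : T) A x x.

Fixpoint cprod (X : Type) (ls : seq (seq X)) : seq (seq X) :=
  match ls with
  | [::] => [:: [::]]
  | l :: ls' => [seq x :: t | x <- l, t <- cprod ls']
  end.

End Generic.

Inductive sharp := Cy | Ra.

Section RIS.
Variable R : realType.
Local Notation C := R[i].
Variables (dS M : nat) (dE : 'I_M -> nat).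
Variables (HS : 'M[C]_dS) (HE : forall j : 'I_M, 'M[C]_(dE j))
          (V : forall j : 'I_M, 'M[C]_(dS * dE j)).
Variables (tau : 'I_M -> R) (betaref : R).

Definition Htot (j : 'I_M) : 'M[C]_(dS * dE j) :=
  HS *t (1%:M : 'M[C]_(dE j)) + (1%:M : 'M[C]_dS) *t HE j + V j.

Definition Uj (j : 'I_M) : 'M[C]_(dS * dE j) :=
  mxfun (fun x => cexp (- (Complex 0 (tau j)) * x)) (Htot j).

Definition betaj (zeta : 'I_M -> R) (j : 'I_M) : R := betaref - zeta j.

Definition rhoE (zeta : 'I_M -> R) (j : 'I_M) : 'M[C]_(dE j) :=
  gibbs (betaj zeta j) (HE j).

Definition Lj zeta j (X : 'M[C]_dS) : 'M[C]_dS :=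
  ptr (Uj j *m (X *t rhoE zeta j) *m mxadj (Uj j)).
Definition Lcy zeta (X : 'M[C]_dS) : 'M[C]_dS :=
  foldl (fun Y j => Lj zeta j Y) X (enum 'I_M).        (* L_M o ... o L_1 *)
Definition Lra zeta (X : 'M[C]_dS) : 'M[C]_dS :=
  (M%:R)^-1 *: \sum_(j < M) Lj zeta j X.

Definition Lsharp (sh : sharp) zeta := match sh with Cy => Lcy zeta | Ra => Lra zeta end.

Definition ER (sh : sharp) : Prop := exists zeta, primitive (Lsharp sh zeta).

Definition Ldj zeta (a : 'I_M -> C) j (X : 'M[C]_dS) : 'M[C]_dS :=
  ptr (((1%:M : 'M[C]_dS) *t mxpow (rhoE zeta j) (1 - a j)) *m mxadj (Uj j)
         *m (X *t mxpow (rhoE zeta j) (a j)) *m Uj j).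
Definition Ldcy zeta a (X : 'M[C]_dS) : 'M[C]_dS :=
  foldr (fun j Y => Ldj zeta a j Y) X (enum 'I_M).    (* L_1^* o ... o L_M^* *)
Definition Ldrcy zeta a (X : 'M[C]_dS) : 'M[C]_dS :=
  foldl (fun Y j => Ldj zeta a j Y) X (enum 'I_M).    (* L_M^* o ... o L_1^* *)
Definition Ldra zeta a (X : 'M[C]_dS) : 'M[C]_dS :=
  (M%:R)^-1 *: \sum_(j < M) Ldj zeta a j X.

Definition rcy zeta a : R := specrad (Ldcy zeta a).
Definition rrcy zeta a : R := specrad (Ldrcy zeta a).
Definition rra zeta a : R := specrad (Ldra zeta a).
Definition rsharp (sh : sharp) zeta a : R :=
  match sh with Cy => rcy zeta a | Ra => rra zeta a end.

Definition NE : Prop :=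
  exists rhop : R -> 'M[C]_dS, (forall z, is_state (rhop z)) /\
    forall (j : 'I_M) (z : R),
      Uj j *m (rhop z *t gibbs (betaref - z) (HE j)) *m mxadj (Uj j)
      = rhop z *t gibbs (betaref - z) (HE j).

Definition TRI : Prop :=
  exists (W : 'M[C]_dS) (WE : forall j : 'I_M, 'M[C]_(dE j)),
    antiunitary_involution W /\ anticommutes W HS /\
    forall j, antiunitary_involution (WE j) /\ anticommutes (WE j) (HE j) /\
              anticommutes (W *t WE j) (V j).

(* Hilbert space of S + E^1 + ... + E^N, probe n being a copy of E_{j n} *)
Definition Tot (N : nat) (j : 'I_N -> 'I_M) : finType :=
  ('I_dS * {dffun forall n : 'I_N, 'I_(dE (j n))})%type.

Section FCS.
Variables (zeta : 'I_M -> R) (N : nat) (j : 'I_N -> 'I_M).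

Definition others (n : 'I_N) (x y : Tot j) : C :=
  \prod_(m < N | m != n) ((x.2 m == y.2 m)%:R : C).

Definition liftSE (n : 'I_N) (A : 'M[C]_(dS * dE (j n))) : op R (Tot j) :=
  fun x y => A (mxtens_index (x.1, x.2 n)) (mxtens_index (y.1, y.2 n)) * others n x y.
Definition liftE (n : 'I_N) (A : 'M[C]_(dE (j n))) : op R (Tot j) :=
  fun x y => (x.1 == y.1)%:R * A (x.2 n) (y.2 n) * others n x y.

Definition rhotot (rho : 'M[C]_dS) : op R (Tot j) :=
  fun x y => rho x.1 y.1 * \prod_(n < N) rhoE zeta (j n) (x.2 n) (y.2 n).

Definition Sop (k : 'I_M) : 'M[C]_(dE k) := (betaj zeta k)%:C *: HE k.

Definition pairs (k : 'I_M) : seq (C * C) :=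
  [seq (s, s') | s <- spec (Sop k), s' <- spec (Sop k)].

Definition outcomes : seq (seq (C * C)) := cprod [seq pairs (j n) | n <- enum 'I_N].

Definition step (s : seq (C * C)) (n : 'I_N) : op R (Tot j) :=
  omul (liftE (specproj (Sop (j n)) (nth (0, 0) s n).2))
       (omul (liftSE (Uj (j n))) (liftE (specproj (Sop (j n)) (nth (0, 0) s n).1))).

(* U^s_N = Pi_{s'_N} U_N Pi_{s_N} ... Pi_{s'_1} U_1 Pi_{s_1} *)
Definition Ucal (s : seq (C * C)) : op R (Tot j) :=
  \big[(fun A B => omul B A) / @oid R (Tot j)]_(n < N) step s n.

Definition prob (rho : 'M[C]_dS) (s : seq (C * C)) : C :=
  otr (omul (omul (Ucal s) (rhotot rho)) (oadj (Ucal s))).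

(* r^j_{N,rho}(alpha) = E( exp(- sum_j alpha_j S^N_{R_j}) ) *)
Definition mgf (rho : 'M[C]_dS) (a : 'I_M -> C) : C :=
  \sum_(s <- outcomes) prob rho s *
    cexp (- \sum_(n < N) a (j n) * ((nth (0, 0) s n).2 - (nth (0, 0) s n).1)).

End FCS.

Definition jcy (hM : (0 < M)%N) (K : nat) : 'I_K -> 'I_M :=
  fun n => Ordinal (ltn_pmod n hM).

Definition mgf_cy (hM : (0 < M)%N) zeta (N : nat) rho a : C :=
  mgf zeta (@jcy hM (N * M)%N) rho a.

(* expectation over the uniform product measure: only j_1..j_N matter *)
Definition mgf_ra zeta (N : nat) rho a : C :=
  (M%:R ^+ N)^-1 * \sum_(w : {ffun 'I_N -> 'I_M}) mgf zeta w rho a.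

Definition mgf_sharp (sh : sharp) (hM : (0 < M)%N) zeta N rho a : C :=
  match sh with Cy => mgf_cy hM zeta N rho a | Ra => mgf_ra zeta N rho a end.

End RIS.

(* Main.v *)
Require Import Defs.
From HB Require Import structures.
From mathcomp Require Import all_boot all_order all_algebra.
From mathcomp Require Import all_classical all_reals all_analysis.
From mathcomp Require Import complex mxtens ring lra.
Set Implicit Arguments.
Unset Strict Implicit.
Unset Printing Implicit Defensive.
Import Order.TTheory GRing.Theory Num.Theory.
Import numFieldNormedType.Exports.
Local Open Scope ring_scope.
Local Open Scope classical_set_scope.
Local Open Scope complex_scope.

(** Measuring every probe before and after its collision makes each step of the moment generating
    function the predual of a deformed map, so that the function after n steps equals
    Tr(rho Phi^n(1)) with Phi the deformed map. The map Phi is Psi(U^*, A, B) for positive definite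
    A, B depending on (zeta, alpha), and any two such maps dominate each other up to a constant on
    the positive cone; hence primitivity at one zeta makes some power of Phi send every nonzero
    positive matrix to a positive definite one, for all zeta and alpha. A Perron-Frobenius
    eigenvector X > 0, Phi(X) = r X, then gives c X <= 1 <= C X, so Tr(rho Phi^n(1)) is of order r^n
    and r is the spectral radius.

    Time reversal conjugates the deformed map at 1 - alpha into the predual of the one at alpha, with
    the order of the factors reversed by duality. Under (NE), U_j commutes with
    rho_+ (x) exp(- lambda H_E), which makes the maps at alpha and alpha + lambda / beta similar
    through X |-> X rho_+; rho_+ is invertible because it is fixed by an improving map. *)
(** * Adjoints and functional calculus *)

(** Domination rests on monotonicity: on positive X, Psi(U, A, B)(X) increases with A and with B,
    and two positive definite matrices bound each other up to constants. Real alpha keeps the powers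
    of the Gibbs states positive definite. Primitivity is stated through Kraus operators, which do
    not compare across parameters, so it is first turned into a property of the cone that survives
    domination and trace duality. The powers of the Gibbs state come from functional calculus: the
    final projections weighted by exp(- alpha s') sum to a multiple of rho_E to the alpha, and the
    initial ones, weighted by exp(alpha s) and multiplied by rho_E, to a multiple of rho_E to the 1
    - alpha. The partition functions in the two multiples cancel. Probe configurations form a
    dependent product. Instead of splitting off its factors, sums over whole configurations are
    compared with iterated sums over single probes up to explicit multiplicities, which are
    cancelled once all probes have been treated. *)

Lemma hermitian_diag (K : numClosedFieldType) n (A : 'M[K]_n) :
  (forall i j, Num.conj (A j i) = A i j) ->
  exists (P : 'M[K]_n) (d : 'I_n -> K),
   [/\ forall i j, \sum_k P i k * Num.conj (P j k) = (i == j)%:R,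
   forall i, d i \is Num.real &
   forall i j, A i j = \sum_k Num.conj (P k i) * d k * P k j].
Proof.
move=> hA.
have hherm : A \is hermsymmx.
  apply/is_hermitianmxP; rewrite expr0 scale1r; apply/matrixP => i j.
  by rewrite !mxE hA.
have hU := spectral_unitarymx A.
exists (spectralmx A), (fun i => spectral_diag A 0 i); split => [i j|i|i j].
- by move/unitarymxP/matrixP/(_ i j): hU; rewrite !mxE => <-; apply: eq_bigr => k _; rewrite !mxE.
- by have /mxOverP := hermitian_spectral_diag_real hherm; apply.
have /orthomx_spectralP {1}-> := hermitian_normalmx hherm.
rewrite invmx_unitary // mxE; apply: eq_bigr => k _.
by rewrite mul_mx_diag !mxE.
Qed.

Section Adjoint.
Variable R : realType.
Local Notation C := R[i].
Implicit Types (m n p q : nat).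

Lemma mxadjE m n (A : 'M[C]_(m, n)) i j : mxadj A i j = conjc (A j i).
Proof. by rewrite !mxE. Qed.

Lemma mxadjK m n : cancel (@mxadj R m n) (@mxadj R n m).
Proof. by move=> A; apply/matrixP => i j; rewrite !mxadjE conjcK. Qed.

Lemma mxadjM m n p (A : 'M[C]_(m, n)) (B : 'M[C]_(n, p)) :
  mxadj (A *m B) = mxadj B *m mxadj A.
Proof. by rewrite /mxadj map_mxM trmx_mul. Qed.

Lemma mxadjD m n (A B : 'M[C]_(m, n)) : mxadj (A + B) = mxadj A + mxadj B.
Proof. by apply/matrixP => i j; rewrite !(mxadjE, mxE) rmorphD. Qed.

Lemma mxadjB m n (A B : 'M[C]_(m, n)) : mxadj (A - B) = mxadj A - mxadj B.
Proof. by apply/matrixP => i j; rewrite !(mxadjE, mxE) rmorphB. Qed.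

Lemma mxadjZ m n (c : C) (A : 'M[C]_(m, n)) : mxadj (c *: A) = conjc c *: mxadj A.
Proof. by apply/matrixP => i j; rewrite !(mxadjE, mxE) rmorphM. Qed.

Lemma mxadj0 m n : mxadj (0 : 'M[C]_(m, n)) = 0.
Proof. by apply/matrixP => i j; rewrite !(mxadjE, mxE) conjc0. Qed.

Lemma mxadj_sum I (r : seq I) (Q : pred I) m n (F : I -> 'M[C]_(m, n)) :
  mxadj (\sum_(i <- r | Q i) F i) = \sum_(i <- r | Q i) mxadj (F i).
Proof. by elim/big_rec2: _ => [|i A B _ <-]; rewrite ?mxadj0 ?mxadjD. Qed.

Lemma mxadj1 n : mxadj (1%:M : 'M[C]_n) = 1%:M.
Proof. by apply/matrixP => i j; rewrite !(mxadjE, mxE) rmorph_nat eq_sym. Qed.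

Lemma mxadj_tens m n p q (A : 'M[C]_(m, n)) (B : 'M[C]_(p, q)) :
  mxadj (A *t B) = mxadj A *t mxadj B.
Proof. by rewrite /mxadj map_mxT trmx_tens. Qed.

Lemma unitarymatrix_adj n (U : 'M[C]_n) : unitarymatrix U -> unitarymatrix (mxadj U).
Proof. by rewrite /unitarymatrix mxadjK => /mulmx1C. Qed.

Lemma unitarymatrixV n (U : 'M[C]_n) : unitarymatrix U -> mxadj U *m U = 1%:M.
Proof. by move/mulmx1C. Qed.

Lemma unitarymatrixM n (U W : 'M[C]_n) :
  unitarymatrix U -> unitarymatrix W -> unitarymatrix (U *m W).
Proof.
by move=> hU hW; rewrite /unitarymatrix mxadjM mulmxA -(mulmxA U) hW mulmx1.
Qed.

(** For a fixed unitary [P] these matrices form a commutative algebra with pointwise operations in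
    [d], so every identity between functions of one Hamiltonian reduces to an identity of
    scalars. *)
Definition udiag n (P : 'M[C]_n) (d : 'I_n -> C) : 'M[C]_n :=
  mxadj P *m diag_mx (\row_i d i) *m P.

Lemma eq_udiag n (P : 'M[C]_n) d e : d =1 e -> udiag P d = udiag P e.
Proof. by move=> /funext ->. Qed.

Lemma udiagM n (P : 'M[C]_n) d e : unitarymatrix P ->
  udiag P d *m udiag P e = udiag P (fun i => d i * e i).
Proof.
move=> hP; rewrite /udiag !mulmxA -(mulmxA _ P) hP mulmx1.
rewrite -(mulmxA (mxadj P)) mulmx_diag; congr (_ *m diag_mx _ *m _).
by apply/rowP => i; rewrite !mxE.
Qed.

Lemma udiagZ n (P : 'M[C]_n) c d : c *: udiag P d = udiag P (fun i => c * d i).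
Proof.
rewrite /udiag scalemxAl scalemxAr -linearZ; congr (_ *m diag_mx _ *m _).
by apply/rowP => i; rewrite !mxE.
Qed.

Lemma udiagD n (P : 'M[C]_n) d e : udiag P d + udiag P e = udiag P (fun i => d i + e i).
Proof.
rewrite /udiag -mulmxDl -mulmxDr -linearD; congr (_ *m diag_mx _ *m _).
by apply/rowP => i; rewrite !mxE.
Qed.

Lemma udiagB n (P : 'M[C]_n) d e : udiag P d - udiag P e = udiag P (fun i => d i - e i).
Proof.
by rewrite -scaleN1r udiagZ udiagD; apply: eq_udiag => i; rewrite mulN1r.
Qed.

Lemma udiag1 n (P : 'M[C]_n) c : unitarymatrix P -> udiag P (fun=> c) = c%:M.
Proof.
move=> hP; rewrite -[c%:M]mulmx1 mul_scalar_mx -(unitarymatrixV hP) scalemxAr.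
rewrite /udiag -mulmxA; congr (_ *m _); rewrite -mul_scalar_mx; congr (_ *m _).
by apply/matrixP => i j; rewrite !mxE.
Qed.

Lemma udiag_sum n (P : 'M[C]_n) I (r : seq I) (Q : pred I) (F : I -> 'I_n -> C) :
  \sum_(l <- r | Q l) udiag P (F l) = udiag P (fun i => \sum_(l <- r | Q l) F l i).
Proof.
elim: r => [|l r IHr].
  rewrite big_nil -[LHS](scale0r (udiag P (fun=> 0))) udiagZ.
  by apply: eq_udiag => i; rewrite mul0r big_nil.
rewrite big_cons IHr; case h: (Q l); rewrite ?udiagD; by apply: eq_udiag => i; rewrite big_cons h.
Qed.

Lemma udiag_prod n (P : 'M[C]_n) I (r : seq I) (Q : pred I) (F : I -> 'I_n -> C) :
  unitarymatrix P ->
  \prod_(l <- r | Q l) udiag P (F l) = udiag P (fun i => \prod_(l <- r | Q l) F l i).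
Proof.
move=> hP; elim: r => [|l r IHr].
  rewrite big_nil -[LHS]/(1%:M) -(udiag1 1 hP).
  by apply: eq_udiag => i; rewrite big_nil.
rewrite big_cons IHr; case h: (Q l); last by apply: eq_udiag => i; rewrite big_cons h.
apply: etrans (udiagM _ _ hP) _.
by apply: eq_udiag => i; rewrite big_cons h.
Qed.

Lemma udiag_adj n (P : 'M[C]_n) d : mxadj (udiag P d) = udiag P (fun i => conjc (d i)).
Proof.
rewrite /udiag !mxadjM mxadjK mulmxA; congr (_ *m _ *m _).
apply/matrixP => i j; rewrite mxadjE !mxE rmorphMn.
by case: eqVneq => [->|]; rewrite ?eqxx // eq_sym => /negPf ->.
Qed.

Lemma udiag_unitary n (P : 'M[C]_n) d : unitarymatrix P ->
  (forall i, d i * conjc (d i) = 1) -> unitarymatrix (udiag P d).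
Proof.
by move=> hP hd; rewrite /unitarymatrix udiag_adj udiagM // -(udiag1 1 hP); apply: eq_udiag.
Qed.

Lemma mxtrace_udiag n (P : 'M[C]_n) d : unitarymatrix P -> \tr (udiag P d) = \sum_i d i.
Proof.
move=> hP; rewrite /udiag mxtrace_mulC mulmxA hP mul1mx mxtrace_diag.
by apply: eq_bigr => i _; rewrite mxE.
Qed.

(** Both products with [z] are the squared modulus, and a nonzero [z] cancels. This carries the
    spectral theorem, phrased with [Num.conj], over to [mxadj], which uses [conjc]. *)
Lemma conjCE (z : C) : Num.conj z = conjc z.
Proof.
have := sqr_normc z; rewrite normCK.
have [->|nz] := eqVneq z 0; first by rewrite !rmorph0.
by move/(mulfI nz).
Qed.

Lemma selfadjoint_udiag n (A : 'M[C]_n) : selfadjoint A ->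
  exists (P : 'M[C]_n) (d : 'I_n -> R),
    unitarymatrix P /\ A = udiag P (fun i => (d i)%:C).
Proof.
move=> hA.
have hA' i j : Num.conj (A j i) = A i j by rewrite conjCE -{2}hA mxadjE.
have [P [d [h1 h2 h3]]] := hermitian_diag hA'.
exists P, (fun i => complex.Re (d i)); split.
  apply/matrixP => i j; rewrite !mxE -h1; apply: eq_bigr => k _.
  by rewrite mxadjE conjCE.
apply/matrixP => i j; rewrite h3 /udiag mxE; apply: eq_bigr => k _.
by rewrite mul_mx_diag !mxE conjCE RRe_real.
Qed.

Lemma eigenvalue_udiag n (P : 'M[C]_n) d z : unitarymatrix P ->
  eigenvalue (udiag P d) z <-> exists i, d i = z.
Proof.
move=> hP; split=> [/eigenvalueP[v hv v0]|[i <-]].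
  have [w wE] : exists w, w = v *m mxadj P by exists (v *m mxadj P).
  have hw : w *m diag_mx (\row_i d i) = z *: w.
    move/(congr1 (fun M => M *m mxadj P)): hv.
    by rewrite wE /udiag -!mulmxA hP mulmx1 mulmxA -scalemxAl.
  have w0 : w != 0.
    by apply: contraNneq v0 => h; rewrite -[v]mulmx1 -(unitarymatrixV hP) mulmxA -wE h mul0mx.
  have [i wi] : exists i, w 0 i != 0.
    apply/existsP; apply: contraNT w0 => /existsPn h; apply/eqP/rowP => i.
    by rewrite [RHS]mxE; apply/eqP/negPn; have := h i.
  exists i; move/rowP/(_ i): hw; rewrite mul_mx_diag !mxE mulrC => h.
  exact: (mulIf wi).
apply/eigenvalueP; exists (row i P).
  rewrite -row_mul /udiag !mulmxA hP mul1mx; apply/rowP => j.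
  by rewrite mxE mul_diag_mx !mxE.
apply/eqP => /(congr1 (fun v => (v *m mxadj P) 0 i)).
rewrite -row_mul hP mul0mx !mxE eqxx; exact/eqP/oner_neq0.
Qed.

(** [spec] is picked by [xget], so its properties hold once some duplicate-free list of the
    eigenvalues is exhibited; [undup] of the values of [d] is one. *)
Lemma spec_udiag n (P : 'M[C]_n) d : unitarymatrix P ->
  uniq (spec (udiag P d)) /\ forall z, z \in spec (udiag P d) <-> exists i, d i = z.
Proof.
move=> hP; rewrite /spec.
set S := [set s | _]; have [] : S (xget [::] S).
  apply: (xgetPex [::]); exists (undup [seq d i | i <- enum 'I_n]); split.
    exact: undup_uniq.
  move=> z; rewrite mem_undup; split=> [/mapP[i _ ->]|/(eigenvalue_udiag _ _ hP)[i <-]].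
    by apply/(eigenvalue_udiag _ _ hP); exists i.
  by rewrite map_f // mem_enum.
move=> h1 h2; split=> // z; split=> [/h2/(eigenvalue_udiag _ _ hP)|h] //.
exact/h2/(eigenvalue_udiag _ _ hP).
Qed.

(** At the eigenvalue [d i] every factor of the Lagrange product is 1 when [d i = l]; otherwise the
    factor with [m = d i] vanishes. *)
Lemma specproj_udiag n (P : 'M[C]_n) d l : unitarymatrix P ->
  specproj (udiag P d) l = udiag P (fun i => (d i == l)%:R).
Proof.
move=> hP; have [su sE] := spec_udiag d hP.
rewrite /specproj (eq_bigr (fun m : C => udiag P (fun i => (l - m)^-1 * (d i - m)))); last first.
  by move=> c _; rewrite -(udiag1 c hP) udiagB udiagZ.
rewrite udiag_prod //; apply: eq_udiag => i.
have [<-|dl] := eqVneq (d i) l.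
  rewrite big1_seq // => m /andP[ml _]; rewrite mulVf // subr_eq0 eq_sym //.
have di : d i \in spec (udiag P d) by apply/sE; exists i.
by rewrite (big_rem _ di) /= dl subrr mulr0 mul0r.
Qed.

Lemma mxfun_udiag n (P : 'M[C]_n) d f : unitarymatrix P ->
  mxfun f (udiag P d) = udiag P (fun i => f (d i)).
Proof.
move=> hP; have [su sE] := spec_udiag d hP.
rewrite /mxfun (eq_bigr (fun l => udiag P (fun i => f l * (d i == l)%:R))); last first.
  by move=> m _; rewrite specproj_udiag // udiagZ.
rewrite udiag_sum //; apply: eq_udiag => i.
have di : d i \in spec (udiag P d) by apply/sE; exists i.
rewrite (bigD1_seq _ di su) /= eqxx mulr1 big1 ?addr0 // => l.
by rewrite eq_sym => /negPf ->; rewrite mulr0.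
Qed.
End Adjoint.

(** * Positive semidefinite matrices *)

Section Positive.
Variable R : realType.
Local Notation C := R[i].

Definition qform n (A : 'M[C]_n) (v : 'cV[C]_n) : C := (mxadj v *m A *m v) 0 0.

Definition posdef n (A : 'M[C]_n) : Prop :=
  selfadjoint A /\ forall v, v != 0 -> 0 < qform A v.

Lemma sqnormE m (w : 'cV[C]_m) : (mxadj w *m w) 0 0 = \sum_k w k 0 * conjc (w k 0).
Proof. by rewrite mxE; apply: eq_bigr => k _; rewrite mxadjE mulrC. Qed.

Lemma sqnorm_ge0 m (w : 'cV[C]_m) : 0 <= (mxadj w *m w) 0 0.
Proof. by rewrite sqnormE; apply: sumr_ge0 => k _; exact: mulcJ_ge0. Qed.

Lemma sqnorm_eq0 m (w : 'cV[C]_m) : (mxadj w *m w) 0 0 = 0 -> w = 0.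
Proof.
rewrite sqnormE => h; apply/colP => k; rewrite [RHS]mxE.
have := @psumr_eq0P _ _ _ _ (fun i _ => mulcJ_ge0 (w i 0)) h k isT.
by move/eqP; rewrite mulf_eq0 conjc_eq0 orbb => /eqP.
Qed.

Lemma qformD n (A B : 'M[C]_n) v : qform (A + B) v = qform A v + qform B v.
Proof. by rewrite /qform mulmxDr mulmxDl mxE. Qed.

Lemma qformZ n (A : 'M[C]_n) c v : qform (c *: A) v = c * qform A v.
Proof. by rewrite /qform -scalemxAr -scalemxAl mxE. Qed.

Lemma qform_conj m n (A : 'M[C]_n) (B : 'M[C]_(n, m)) v :
  qform (mxadj B *m A *m B) v = qform A (B *m v).
Proof. by rewrite /qform mxadjM !mulmxA. Qed.

Lemma qform_gram m n (B : 'M[C]_(m, n)) v :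
  qform (mxadj B *m B) v = (mxadj (B *m v) *m (B *m v)) 0 0.
Proof. by rewrite /qform mxadjM !mulmxA. Qed.

Lemma qform_trace n (A : 'M[C]_n) v : qform A v = \tr (A *m (v *m mxadj v)).
Proof. by rewrite mulmxA mxtrace_mulC mulmxA /qform trace_mx11. Qed.

Lemma selfadjointD n (A B : 'M[C]_n) :
  selfadjoint A -> selfadjoint B -> selfadjoint (A + B).
Proof. by rewrite /selfadjoint mxadjD => -> ->. Qed.

Lemma selfadjointZ n (A : 'M[C]_n) (c : R) :
  selfadjoint A -> selfadjoint (c%:C *: A).
Proof. by rewrite /selfadjoint mxadjZ conjc_real => ->. Qed.

Lemma selfadjoint_tens m n (A : 'M[C]_m) (B : 'M[C]_n) :
  selfadjoint A -> selfadjoint B -> selfadjoint (A *t B).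
Proof. by rewrite /selfadjoint mxadj_tens => -> ->. Qed.

Lemma selfadjoint1 n : selfadjoint (1%:M : 'M[C]_n).
Proof. exact: mxadj1. Qed.

Lemma ge0_conjc (z : C) : 0 <= z -> conjc z = z.
Proof. by case: z => a b; rewrite lecE /= => /andP[/eqP -> _]; rewrite oppr0. Qed.

Lemma psdE n (A : 'M[C]_n) :
  psd A = (selfadjoint A /\ forall v, 0 <= qform A v).
Proof. by []. Qed.

Lemma psdD n (A B : 'M[C]_n) : psd A -> psd B -> psd (A + B).
Proof.
rewrite !psdE => -[hA pA] [hB pB]; split; first exact: selfadjointD.
by move=> v; rewrite qformD addr_ge0.
Qed.

Lemma psdZ n (A : 'M[C]_n) c : 0 <= c -> psd A -> psd (c *: A).
Proof.
rewrite !psdE => c0 [hA pA]; split; first by rewrite /selfadjoint mxadjZ hA ge0_conjc.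
by move=> v; rewrite qformZ mulr_ge0.
Qed.

Lemma psd_gram m n (B : 'M[C]_(m, n)) : psd (mxadj B *m B).
Proof.
rewrite psdE; split; first by rewrite /selfadjoint mxadjM mxadjK.
by move=> v; rewrite qform_gram sqnorm_ge0.
Qed.

Lemma psd0 n : psd (0 : 'M[C]_n).
Proof. by have := psd_gram (0 : 'M[C]_n); rewrite mulmx0. Qed.

Lemma psd_sum n I (r : seq I) (Q : pred I) (F : I -> 'M[C]_n) :
  (forall i, Q i -> psd (F i)) -> psd (\sum_(i <- r | Q i) F i).
Proof.
move=> h; elim/big_rec: _ => [|i A Qi pA]; first exact: psd0.
by apply: psdD => //; apply: h.
Qed.

Lemma psd_conj m n (A : 'M[C]_n) (B : 'M[C]_(n, m)) :
  psd A -> psd (mxadj B *m A *m B).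
Proof.
rewrite !psdE => -[hA pA]; split; first by rewrite /selfadjoint !mxadjM mxadjK hA mulmxA.
by move=> v; rewrite qform_conj; apply: pA.
Qed.

Lemma psd_conjV m n (A : 'M[C]_n) (B : 'M[C]_(m, n)) :
  psd A -> psd (B *m A *m mxadj B).
Proof. by move=> h; have := psd_conj (mxadj B) h; rewrite mxadjK. Qed.

Lemma qform_udiag n (P : 'M[C]_n) d v :
  qform (udiag P d) v = \sum_k d k * ((P *m v) k 0 * conjc ((P *m v) k 0)).
Proof.
rewrite /udiag qform_conj; move: (P *m v) => w.
rewrite /qform -mulmxA mxE; apply: eq_bigr => k _.
by rewrite mul_diag_mx mxadjE !mxE mulrCA [conjc _ * _]mulrC.
Qed.

Lemma psd_udiag n (P : 'M[C]_n) d : (forall i, 0 <= d i) -> psd (udiag P d).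
Proof.
move=> h; rewrite psdE; split.
  by rewrite /selfadjoint udiag_adj; apply: eq_udiag => i; rewrite ge0_conjc.
move=> v; rewrite qform_udiag; apply: sumr_ge0 => k _.
by rewrite mulr_ge0 ?mulcJ_ge0.
Qed.

Lemma mul_unitary_neq0 n (P : 'M[C]_n) (v : 'cV[C]_n) : unitarymatrix P ->
  v != 0 -> P *m v != 0.
Proof.
move=> hP; apply: contraNneq => h.
by rewrite -[v]mul1mx -(unitarymatrixV hP) -mulmxA h mulmx0.
Qed.

Lemma cV_neq0_ex n (w : 'cV[C]_n) : w != 0 -> exists k, w k 0 != 0.
Proof.
move=> w0; apply/existsP; apply: contraNT w0 => /existsPn h; apply/eqP/colP => i.
by rewrite [RHS]mxE; apply/eqP/negPn; have := h i.
Qed.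

Lemma mulcJ_gt0 (z : C) : z != 0 -> 0 < z * conjc z.
Proof. by move=> z0; rewrite lt_def mulcJ_ge0 mulf_neq0 // conjc_eq0. Qed.

Lemma posdef_udiag n (P : 'M[C]_n) d : unitarymatrix P ->
  (forall i, 0 < d i) -> posdef (udiag P d).
Proof.
move=> hP h; split; first by have [] := psd_udiag P (fun i => ltW (h i)).
move=> v /(mul_unitary_neq0 hP)/cV_neq0_ex[k wk].
rewrite qform_udiag (bigD1 k) //=; apply: ltr_wpDr.
  by apply: sumr_ge0 => i _; apply: mulr_ge0 (ltW (h i)) _; exact: mulcJ_ge0.
by apply: mulr_gt0 (h k) _; exact: mulcJ_gt0.
Qed.

Lemma posdef1 n : posdef (1%:M : 'M[C]_n).
Proof.
have h : unitarymatrix (1%:M : 'M[C]_n) by rewrite /unitarymatrix mxadj1 mulmx1.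
by rewrite -(udiag1 1 h); apply: posdef_udiag => // i; exact: ltr01.
Qed.


(** The vector is the eigenvector of index [k]; testing the form on it converts positivity of the
    matrix into positivity of its eigenvalues. *)
Lemma qform_udiag_delta n (P : 'M[C]_n) d k : unitarymatrix P ->
  qform (udiag P d) (mxadj P *m delta_mx k 0) = d k.
Proof.
move=> hP; rewrite qform_udiag mulmxA hP mul1mx (bigD1 k) //= big1 => [|i ik].
  by rewrite !mxE !eqxx conjc1 !mulr1 addr0.
by rewrite !mxE (negPf ik) /= mul0r mulr0.
Qed.

Lemma psd_udiag_inv n (P : 'M[C]_n) d : unitarymatrix P ->
  psd (udiag P d) -> forall i, 0 <= d i.
Proof. by rewrite psdE => hP [_ h] i; rewrite -(qform_udiag_delta d i hP). Qed.

Lemma delta_unitary_neq0 n (P : 'M[C]_n) (k : 'I_n) : unitarymatrix P ->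
  mxadj P *m delta_mx k 0 != 0 :> 'cV[C]_n.
Proof.
move=> hP; apply: mul_unitary_neq0; first exact: unitarymatrix_adj.
by apply/eqP => /colP/(_ k)/eqP; rewrite !mxE !eqxx oner_eq0.
Qed.

Lemma posdef_udiag_inv n (P : 'M[C]_n) d : unitarymatrix P ->
  posdef (udiag P d) -> forall i, 0 < d i.
Proof.
move=> hP [_ h] i; rewrite -(qform_udiag_delta d i hP); apply: h.
exact: delta_unitary_neq0.
Qed.

(** The square root of the eigenvalues gives [B]. Positivity of traces, tensor products and partial
    traces is obtained from this form as a sum of squares. *)
Lemma psd_gramP n (A : 'M[C]_n) : psd A -> exists B : 'M[C]_n, A = mxadj B *m B.
Proof.
move=> pA; have [hA _] := pA; have [P [d [hP AE]]] := selfadjoint_udiag hA.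
have d0 i : 0 <= d i by have := pA; rewrite AE => /(psd_udiag_inv hP)/(_ i); rewrite ler0c.
exists (udiag P (fun i => (Num.sqrt (d i))%:C)).
rewrite udiag_adj udiagM // AE; apply: eq_udiag => i.
by rewrite conjc_real -rmorphM /= -expr2 sqr_sqrtr.
Qed.

Lemma posdef_psd n (A : 'M[C]_n) : posdef A -> psd A.
Proof.
rewrite psdE => -[hA pA]; split=> // v.
have [->|/pA/ltW//] := eqVneq v 0; by rewrite /qform mulmx0 mxE.
Qed.

Lemma psd1 n : psd (1%:M : 'M[C]_n).
Proof. by have := psd_gram (1%:M : 'M[C]_n); rewrite mulmx1 mxadj1. Qed.

Lemma psd_tens m n (A : 'M[C]_m) (B : 'M[C]_n) : psd A -> psd B -> psd (A *t B).
Proof.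
move=> /psd_gramP[X ->] /psd_gramP[Y ->].
by rewrite -tensmx_mul -mxadj_tens; apply: psd_gram.
Qed.

Lemma mxtrace_gram m n (B : 'M[C]_(m, n)) :
  \tr (mxadj B *m B) = \sum_i \sum_j B j i * conjc (B j i).
Proof.
apply: eq_bigr => i _; rewrite mxE; apply: eq_bigr => j _.
by rewrite mxadjE mulrC.
Qed.

Lemma psd_trace_ge0 n (A : 'M[C]_n) : psd A -> 0 <= \tr A.
Proof.
move=> /psd_gramP[B ->]; rewrite mxtrace_gram.
by apply: sumr_ge0 => i _; apply: sumr_ge0 => j _; exact: mulcJ_ge0.
Qed.

Lemma psd_trace_gt0 n (A : 'M[C]_n) : psd A -> A != 0 -> 0 < \tr A.
Proof.
move=> pA A0; rewrite lt_def psd_trace_ge0 // andbT.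
have [B AE] := psd_gramP pA; apply: contraNneq A0; rewrite AE mxtrace_gram => h.
suff -> : B = 0 by rewrite mulmx0.
apply/matrixP => j i; rewrite [RHS]mxE.
have h1 (k : 'I_n) : 0 <= \sum_l B l k * conjc (B l k).
  by apply: sumr_ge0 => l _; exact: mulcJ_ge0.
have h2 := @psumr_eq0P _ _ _ _ (fun k _ => h1 k) h i isT.
have := @psumr_eq0P _ _ _ _ (fun l _ => mulcJ_ge0 (B l i)) h2 j isT.
by move/eqP; rewrite mulf_eq0 conjc_eq0 orbb => /eqP.
Qed.

Lemma psd_mul_trace_ge0 n (A B : 'M[C]_n) : psd A -> psd B -> 0 <= \tr (A *m B).
Proof.
move=> pA /psd_gramP[Y ->]; rewrite mulmxA mxtrace_mulC mulmxA.
exact/psd_trace_ge0/psd_conjV.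
Qed.

Lemma posdef_lower n (A : 'M[C]_n) : posdef A ->
  exists2 c : R, 0 < c & psd (A - c%:C *: 1%:M).
Proof.
move=> pA; have [hA _] := pA; have [P [d [hP AE]]] := selfadjoint_udiag hA.
have d0 i : 0 < d i by have := pA; rewrite AE => /(posdef_udiag_inv hP)/(_ i); rewrite ltcR.
(* [s] bounds every [(d i)^-1], so [s^-1] lies below all eigenvalues; the leading 1 keeps [s]
   positive when [n = 0]. *)
pose s := 1 + \sum_i (d i)^-1.
have hs i : (d i)^-1 <= s.
  rewrite /s (bigD1 i) //= addrCA lerDl addr_ge0 // sumr_ge0 // => j _.
  by rewrite invr_ge0 ltW.
have s0 : 0 < s by rewrite ltr_pwDl // sumr_ge0 // => j _; rewrite invr_ge0 ltW.
exists s^-1; first by rewrite invr_gt0.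
rewrite scalemx1 -(udiag1 _ hP) AE udiagB; apply: psd_udiag => i.
by rewrite subr_ge0 lecR -[d i]invrK lef_pV2 // posrE ?invr_gt0.
Qed.

Lemma selfadjoint_upper n (A : 'M[C]_n) : selfadjoint A ->
  exists2 c : R, 0 < c & psd (c%:C *: 1%:M - A).
Proof.
move=> hA; have [P [d [hP AE]]] := selfadjoint_udiag hA.
have h i : 0 <= `|d i| by [].
exists (1 + \sum_i `|d i|); first by rewrite ltr_pwDl // sumr_ge0.
rewrite scalemx1 -(udiag1 _ hP) AE udiagB; apply: psd_udiag => i.
rewrite subr_ge0 lecR (le_trans (ler_norm _)) // (bigD1 i) //= addrCA lerDl.
by rewrite addr_ge0 // sumr_ge0.
Qed.

Lemma posdef_dominates n (A B : 'M[C]_n) : posdef A -> selfadjoint B ->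
  exists2 c : R, 0 < c & psd (A - c%:C *: B).
Proof.
move=> /posdef_lower[a a0 hA] /selfadjoint_upper[b b0 hB].
exists (a / b); first by rewrite divr_gt0.
have -> : A - (a / b)%:C *: B = (A - a%:C *: 1%:M) + (a / b)%:C *: (b%:C *: 1%:M - B).
  rewrite scalerBr scalerA -rmorphM /= divfK ?gt_eqF // addrA subrK //.
apply: psdD hA _; apply: psdZ _ hB; rewrite ler0c; exact: divr_ge0 (ltW a0) (ltW b0).
Qed.

Lemma psd_posdef_trace_gt0 n (A B : 'M[C]_n) :
  psd A -> A != 0 -> posdef B -> 0 < \tr (A *m B).
Proof.
move=> pA A0 /posdef_lower[c c0 hB].
rewrite -[B](subrK (c%:C *: 1%:M)) mulmxDr mxtraceD ltr_wpDl ?psd_mul_trace_ge0 //.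
by rewrite -scalemxAr mulmx1 mxtraceZ mulr_gt0 ?psd_trace_gt0 // ltcR.
Qed.

Lemma posdef_le n (A B : 'M[C]_n) : posdef A -> psd (B - A) -> posdef B.
Proof.
move=> [hA pA] [hBA pBA]; rewrite -[B](subrK A); split.
  exact: selfadjointD.
by move=> v v0; rewrite qformD ltr_wpDl ?pA //; apply: pBA.
Qed.

Lemma posdefZ n (A : 'M[C]_n) (c : R) : 0 < c -> posdef A -> posdef (c%:C *: A).
Proof.
move=> c0 [hA pA]; split; first exact: selfadjointZ.
by move=> v v0; rewrite qformZ mulr_gt0 ?pA // ltcR.
Qed.

Lemma posdef_unit n (A : 'M[C]_n) : posdef A -> A \in unitmx.
Proof.
move=> [hA pA]; rewrite -unitmx_tr -row_free_unit -kermx_eq0.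
apply: contraT => /rowV0Pn[v /sub_kermxP hv v0].
have : 0 < qform A v^T.
  by apply: pA; apply: contraNneq v0 => h; rewrite -[v]trmxK h trmx0.
have -> : qform A v^T = 0; last by rewrite ltxx.
by rewrite /qform -mulmxA -[A *m _]trmxK trmx_mul trmxK hv trmx0 mulmx0 mxE.
Qed.

End Positive.

(** * Partial traces and positive maps *)

Section PartialTrace.
Variable R : realType.
Local Notation C := R[i].
Implicit Types d : nat.

Lemma sum_mxtens d1 d2 (V : nmodType) (F : 'I_(d1 * d2) -> V) :
  \sum_k F k = \sum_a \sum_b F (mxtens_index (a, b)).
Proof.
rewrite pair_big /=; apply: (reindex (fun p => mxtens_index (p.1, p.2))) => /=.
exists (@mxtens_unindex d1 d2) => k _; last by rewrite -[RHS]mxtens_unindexK; case: mxtens_unindex.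
by rewrite mxtens_indexK; case: k.
Qed.

Lemma tensmx_mulE d1 d2 n (A : 'M[C]_(d1 * d2)) (B : 'M[C]_(d1 * d2, n)) i j :
  (A *m B) i j = \sum_a \sum_b A i (mxtens_index (a, b)) * B (mxtens_index (a, b)) j.
Proof. by rewrite mxE sum_mxtens. Qed.

Lemma ptrD d1 d2 (A B : 'M[C]_(d1 * d2)) : ptr (A + B) = ptr A + ptr B.
Proof. by apply/matrixP => i j; rewrite !mxE -big_split; apply: eq_bigr => b _; rewrite mxE. Qed.

Lemma ptrZ d1 d2 c (A : 'M[C]_(d1 * d2)) : ptr (c *: A) = c *: ptr A.
Proof. by apply/matrixP => i j; rewrite !mxE mulr_sumr; apply: eq_bigr => b _; rewrite mxE. Qed.

Lemma mxtrace_ptr d1 d2 (A : 'M[C]_(d1 * d2)) : \tr (ptr A) = \tr A.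
Proof. by rewrite /mxtrace sum_mxtens; apply: eq_bigr => a _; rewrite mxE. Qed.

Lemma sum_delta n (i : 'I_n) (F : 'I_n -> C) : \sum_j (i == j)%:R * F j = F i.
Proof.
rewrite (bigD1 i) //= eqxx mul1r big1 ?addr0 // => j.
by rewrite eq_sym => /negPf ->; rewrite mul0r.
Qed.

Lemma ptr_mulr d1 d2 (A : 'M[C]_(d1 * d2)) (Y : 'M[C]_d1) :
  ptr (A *m (Y *t 1%:M)) = ptr A *m Y.
Proof.
apply/matrixP => i j; rewrite !mxE.
under [RHS]eq_bigr => k _ do rewrite mxE mulr_suml.
rewrite [RHS]exchange_big; apply: eq_bigr => b _; rewrite tensmx_mulE.
apply: eq_bigr => a _.
under eq_bigr => b' _ do rewrite tensmxE mxE mulrA eq_sym mulrC.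
by rewrite sum_delta.
Qed.

Lemma ptr_mull d1 d2 (A : 'M[C]_(d1 * d2)) (Y : 'M[C]_d1) :
  ptr ((Y *t 1%:M) *m A) = Y *m ptr A.
Proof.
apply/matrixP => i j; rewrite !mxE.
under [RHS]eq_bigr => k _ do rewrite mxE mulr_sumr.
rewrite [RHS]exchange_big; apply: eq_bigr => b _; rewrite tensmx_mulE.
apply: eq_bigr => a _.
under eq_bigr => b' _ do rewrite tensmxE mxE mulrAC mulrC.
by rewrite sum_delta.
Qed.

(** Cyclicity survives in a partial trace for factors that act on the traced space alone. *)
Lemma ptr_cyclic d1 d2 (A : 'M[C]_(d1 * d2)) (B : 'M[C]_d2) :
  ptr ((1%:M *t B) *m A) = ptr (A *m (1%:M *t B)).
Proof.
apply/matrixP => i j; rewrite !mxE.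
transitivity (\sum_b \sum_b' B b b' * A (mxtens_index (i, b')) (mxtens_index (j, b))).
  apply: eq_bigr => b _; rewrite tensmx_mulE exchange_big /=; apply: eq_bigr => b' _.
  under eq_bigr => a _ do rewrite tensmxE mxE -mulrA.
  by rewrite sum_delta.
rewrite exchange_big; apply: eq_bigr => b _ /=; rewrite tensmx_mulE exchange_big /=.
apply: eq_bigr => b' _.
under eq_bigr => a _ do rewrite tensmxE mxE mulrCA eq_sym.
by rewrite sum_delta mulrC.
Qed.

Lemma psd_ptr d1 d2 (A : 'M[C]_(d1 * d2)) : psd A -> psd (ptr A).
Proof.
move=> /psd_gramP[B ->].
(* Slicing the columns of [B] by their second index writes the partial trace of a Gram matrix as a
   sum of Gram matrices. *)
pose Bb (b : 'I_d2) : 'M[C]_(d1 * d2, d1) := \matrix_(k, a) B k (mxtens_index (a, b)).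
suff -> : ptr (mxadj B *m B) = \sum_b mxadj (Bb b) *m Bb b.
  by apply: psd_sum => b _; apply: psd_gram.
apply/matrixP => i j; rewrite mxE summxE; apply: eq_bigr => b _.
by rewrite !mxE; apply: eq_bigr => k _; rewrite !mxadjE !mxE.
Qed.

(** A common form for the collision maps, their deformations and the preduals of these. Its trace
    dual exchanges [A] with [B] and [U] with [mxadj U], so the family is closed under duality. *)
Definition Psi d1 d2 (U : 'M[C]_(d1 * d2)) (A B : 'M[C]_d2) (X : 'M[C]_d1) : 'M[C]_d1 :=
  ptr ((1%:M *t A) *m U *m (X *t B) *m mxadj U).

Lemma tensmxDl d1 d2 (X Y : 'M[C]_d1) (B : 'M[C]_d2) : (X + Y) *t B = X *t B + Y *t B.
Proof. by apply/matrixP => i j; rewrite !mxE mulrDl. Qed.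

Lemma tensmxDr d1 d2 (X : 'M[C]_d1) (A B : 'M[C]_d2) : X *t (A + B) = X *t A + X *t B.
Proof. by apply/matrixP => i j; rewrite !mxE mulrDr. Qed.

Lemma tensmxZl d1 d2 c (X : 'M[C]_d1) (B : 'M[C]_d2) : (c *: X) *t B = c *: (X *t B).
Proof. by apply/matrixP => i j; rewrite !mxE mulrA. Qed.

Lemma tensmxZr d1 d2 c (X : 'M[C]_d1) (B : 'M[C]_d2) : X *t (c *: B) = c *: (X *t B).
Proof. by apply/matrixP => i j; rewrite !mxE mulrCA. Qed.

Lemma tensmx11 d1 d2 : (1%:M *t 1%:M : 'M[C]_(d1 * d2)) = 1%:M.
Proof.
apply/matrixP => i j; case: (mxtens_indexP i) => a b; case: (mxtens_indexP j) => a' b'.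
rewrite tensmxE !mxE -natrM mulnb -xpair_eqE; congr (_ : bool)%:R.
by rewrite (inj_eq (can_inj (@mxtens_indexK d1 d2))).
Qed.

Lemma Psi_linear d1 d2 (U : 'M[C]_(d1 * d2)) A B : linear (Psi U A B).
Proof.
move=> c X Y; rewrite /Psi tensmxDl tensmxZl mulmxDr mulmxDl ptrD.
by rewrite -scalemxAr -scalemxAl ptrZ.
Qed.

Lemma PsiDl d1 d2 (U : 'M[C]_(d1 * d2)) A A' B X :
  Psi U (A + A') B X = Psi U A B X + Psi U A' B X.
Proof. by rewrite /Psi tensmxDr !mulmxDl ptrD. Qed.

Lemma PsiZl d1 d2 (U : 'M[C]_(d1 * d2)) c A B X : Psi U (c *: A) B X = c *: Psi U A B X.
Proof. by rewrite /Psi tensmxZr -!scalemxAl ptrZ. Qed.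

Lemma PsiDr d1 d2 (U : 'M[C]_(d1 * d2)) A B B' X :
  Psi U A (B + B') X = Psi U A B X + Psi U A B' X.
Proof. by rewrite /Psi tensmxDr mulmxDr mulmxDl ptrD. Qed.

Lemma PsiZr d1 d2 (U : 'M[C]_(d1 * d2)) c A B X : Psi U A (c *: B) X = c *: Psi U A B X.
Proof. by rewrite /Psi tensmxZr -scalemxAr -scalemxAl ptrZ. Qed.

(** With [A = mxadj D *m D], partial cyclicity moves [mxadj D] to the far right, leaving the partial
    trace of [X *t B] conjugated by [(1%:M *t D) *m U]. *)
Lemma Psi_pos d1 d2 (U : 'M[C]_(d1 * d2)) A B X : psd A -> psd B -> psd X -> psd (Psi U A B X).
Proof.
move=> /psd_gramP[D ->] pB pX; rewrite /Psi.
have -> : 1%:M *t (mxadj D *m D) = (1%:M *t mxadj D) *m (1%:M *t D) :> 'M[C]_(d1 * d2).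
  by rewrite tensmx_mul mulmx1.
rewrite -!mulmxA ptr_cyclic !mulmxA.
have -> : 1%:M *t mxadj D = mxadj (1%:M *t D) :> 'M[C]_(d1 * d2) by rewrite mxadj_tens mxadj1.
rewrite -(mulmxA _ (mxadj U)) -mxadjM.
exact/psd_ptr/psd_conjV/psd_tens.
Qed.

(** The pairing is bilinear, so duality preserves eigenvalues instead of conjugating them. *)
Definition tdual n (L L' : 'M[C]_n -> 'M[C]_n) : Prop :=
  forall X Y, \tr (Y *m L X) = \tr (L' Y *m X).

Lemma Psi_dual d1 d2 (U : 'M[C]_(d1 * d2)) A B : tdual (Psi U A B) (Psi (mxadj U) B A).
Proof.
move=> X Y; rewrite /Psi mxadjK -ptr_mull -ptr_mulr !mxtrace_ptr.
rewrite !mulmxA tensmx_mul mul1mx mulmx1.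
rewrite mxtrace_mulC !mulmxA.
rewrite [RHS]mxtrace_mulC !mulmxA tensmx_mul mul1mx mulmx1.
by rewrite mxtrace_mulC !mulmxA.
Qed.

End PartialTrace.

(** * Positive maps: domination on the cone, improving powers, trace duality *)

Section PositiveMaps.
Variable R : realType.
Variable n : nat.
Local Notation C := R[i].
Implicit Types L : 'M[C]_n -> 'M[C]_n.

Definition posmap L : Prop := linear L /\ forall X, psd X -> psd (L X).

Definition dominates L L' : Prop :=
  exists2 c : R, 0 < c & forall X, psd X -> psd (L X - c%:C *: L' X).

(** The power is uniform over the cone. The property speaks of positivity only, so it passes to
    dominating maps and to trace duals. *)
Definition improving L : Prop :=
  exists p : nat, forall X, psd X -> X != 0 -> posdef (iter p L X).

Lemma linmapD L X Y : linear L -> L (X + Y) = L X + L Y.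
Proof. by move=> h; rewrite -[X]scale1r h !scale1r. Qed.

Lemma linmap0 L : linear L -> L 0 = 0.
Proof. by move=> h; have := h (-1) 0 0; rewrite scaler0 addr0 scaleN1r addNr. Qed.

Lemma linmapZ L c X : linear L -> L (c *: X) = c *: L X.
Proof. by move=> h; rewrite -[c *: X]addr0 h (linmap0 h) addr0. Qed.

Lemma linmapB L X Y : linear L -> L (X - Y) = L X - L Y.
Proof. by move=> h; rewrite -scaleN1r (linmapD _ _ h) (linmapZ _ _ h) scaleN1r. Qed.

Lemma linmap_sum L I (r : seq I) (F : I -> 'M[C]_n) : linear L ->
  L (\sum_(i <- r) F i) = \sum_(i <- r) L (F i).
Proof.
by move=> h; elim/big_rec2: _ => [|i A B _ <-]; rewrite ?(linmap0 h) ?(linmapD _ _ h).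
Qed.

Lemma posmap_id : posmap id. Proof. by split=> // c X Y. Qed.

Lemma posmap_comp L L' : posmap L -> posmap L' -> posmap (fun X => L (L' X)).
Proof.
move=> [lL pL] [lL' pL']; split=> [c X Y|X pX]; first by rewrite lL' lL.
exact/pL/pL'.
Qed.

Lemma posmap_sum I (r : seq I) (F : I -> 'M[C]_n -> 'M[C]_n) :
  (forall i, posmap (F i)) -> posmap (fun X => \sum_(i <- r) F i X).
Proof.
move=> h; split=> [c X Y|X pX]; last by apply: psd_sum => i _; have [_] := h i; apply.
by rewrite scaler_sumr -big_split; apply: eq_bigr => i _; have [-> _] := h i.
Qed.

Lemma posmapZ c L : 0 <= c -> posmap L -> posmap (fun X => c *: L X).
Proof.
move=> c0 [lL pL]; split=> [a X Y|X pX]; last by apply: psdZ => //; apply: pL.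
by rewrite lL scalerDr scalerA mulrC -scalerA.
Qed.

Lemma posmap_foldl I (r : seq I) (F : I -> 'M[C]_n -> 'M[C]_n) :
  (forall i, posmap (F i)) -> posmap (fun X => foldl (fun Y i => F i Y) X r).
Proof.
move=> h; elim: r => [|i r IHr] /=; first exact: posmap_id.
exact: (posmap_comp IHr (h i)).
Qed.

Lemma posmap_foldr I (r : seq I) (F : I -> 'M[C]_n -> 'M[C]_n) :
  (forall i, posmap (F i)) -> posmap (fun X => foldr F X r).
Proof.
move=> h; elim: r => [|i r IHr] /=; first exact: posmap_id.
exact: (posmap_comp (h i) IHr).
Qed.

Lemma posmap_iter p L : posmap L -> posmap (iter p L).
Proof.
move=> h; elim: p => [|p IHp] /=; first exact: posmap_id.
exact: (posmap_comp h IHp).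
Qed.

Lemma dominates_refl L : dominates L L.
Proof. by exists 1; [exact: ltr01 | move=> X _]; rewrite scale1r subrr; apply: psd0. Qed.

(** The difference splits as L1 applied to (L2 - b M2) X, plus b times (L1 - a M1) applied to M2
    X. *)
Lemma dominates_comp L1 L2 M1 M2 : posmap L1 -> posmap M2 ->
  dominates L1 M1 -> dominates L2 M2 ->
  dominates (fun X => L1 (L2 X)) (fun X => M1 (M2 X)).
Proof.
move=> [lL1 pL1] [_ pM2] [a a0 ha] [b b0 hb]; exists (a * b) => [|X pX].
  exact: mulr_gt0.
have -> : L1 (L2 X) - (a * b)%:C *: M1 (M2 X) =
    L1 (L2 X - b%:C *: M2 X) + b%:C *: (L1 (M2 X) - a%:C *: M1 (M2 X)).
  rewrite (linmapB _ _ lL1) (linmapZ _ _ lL1) scalerBr scalerA -rmorphM /= (mulrC b a).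
  by rewrite addrA subrK.
apply: psdD; first exact/pL1/hb.
by apply: psdZ; [rewrite ler0c ltW | apply/ha/pM2].
Qed.

(** Inserts intermediate terms: below, [x] and [z] carry the individual domination constants, [y]
    and [t] their minimum. *)
Lemma telescope_sub (V : zmodType) (f s x y z t : V) :
  f + s - (y + t) = (f - x) + (x - y) + ((s - z) + (z - t)).
Proof. by rewrite !addrA !subrK opprD !addrA [f + s - y]addrAC. Qed.

Lemma dominates_sum I (r : seq I) (F G : I -> 'M[C]_n -> 'M[C]_n) :
  (forall i, posmap (G i)) -> (forall i, dominates (F i) (G i)) ->
  dominates (fun X => \sum_(i <- r) F i X) (fun X => \sum_(i <- r) G i X).
Proof.
move=> pG h; elim: r => [|i r [a a0 ha]].
  by exists 1; [exact: ltr01 | move=> X _]; rewrite !big_nil scaler0 subr0; apply: psd0.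
have [b b0 hb] := h i; exists (Num.min a b) => [|X pX]; first by rewrite lt_min a0.
have [_ pGi] := pG i.
have [_ pS] := posmap_sum r pG.
rewrite !big_cons; set S := \sum_(j <- r) G j X; set m := Num.min a b.
have -> : F i X + \sum_(j <- r) F j X - m%:C *: (G i X + S) =
  (F i X - b%:C *: G i X) + (b - m)%:C *: G i X +
  ((\sum_(j <- r) F j X - a%:C *: S) + (a - m)%:C *: S).
  by rewrite !rmorphB /= !scalerBl scalerDr; apply: telescope_sub.
apply: psdD; apply: psdD; [exact: hb | | exact: ha |]; apply: psdZ.
- by rewrite ler0c subr_ge0 ge_min lexx orbT.
- exact: pGi.
- by rewrite ler0c subr_ge0 ge_min lexx.
- exact: pS.
Qed.

Lemma dominatesZ c L L' : 0 <= c -> dominates L L' ->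
  dominates (fun X => c *: L X) (fun X => c *: L' X).
Proof.
move=> c0 [a a0 ha]; exists a; [exact: a0 | move=> X pX].
by rewrite scalerA mulrC -scalerA -scalerBr; apply: psdZ => //; apply: ha.
Qed.

Lemma dominates_foldl I (r : seq I) (F G : I -> 'M[C]_n -> 'M[C]_n) :
  (forall i, posmap (F i)) -> (forall i, posmap (G i)) ->
  (forall i, dominates (F i) (G i)) ->
  dominates (fun X => foldl (fun Y i => F i Y) X r) (fun X => foldl (fun Y i => G i Y) X r).
Proof.
move=> pF pG h; elim: r => [|i r IHr] /=; first exact: dominates_refl.
exact: (dominates_comp (posmap_foldl r pF) (pG i) IHr (h i)).
Qed.

Lemma dominates_iter p L L' : posmap L -> posmap L' -> dominates L L' ->
  dominates (iter p L) (iter p L').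
Proof.
move=> pL pL' h; elim: p => [|p IHp] /=; first exact: dominates_refl.
exact: (dominates_comp pL (posmap_iter p pL') h IHp).
Qed.

Lemma improving_dominates L L' : posmap L -> posmap L' -> dominates L L' ->
  improving L' -> improving L.
Proof.
move=> pL pL' h [p hp]; have [c c0 hc] := dominates_iter p pL pL' h.
exists p => X pX X0; apply: posdef_le (hc X pX).
exact/posdefZ/hp.
Qed.

Lemma tdual_comp L1 L2 M1 M2 : tdual L1 M1 -> tdual L2 M2 ->
  tdual (fun X => L1 (L2 X)) (fun X => M2 (M1 X)).
Proof. by move=> h1 h2 X Y; rewrite h1 h2. Qed.

Lemma tdual_sum I (r : seq I) (F G : I -> 'M[C]_n -> 'M[C]_n) :
  (forall i, tdual (F i) (G i)) ->
  tdual (fun X => \sum_(i <- r) F i X) (fun X => \sum_(i <- r) G i X).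
Proof.
move=> h X Y; rewrite mulmx_sumr mulmx_suml !raddf_sum.
by apply: eq_bigr => i _; apply: h.
Qed.

Lemma tdualZ c L L' : tdual L L' -> tdual (fun X => c *: L X) (fun X => c *: L' X).
Proof. by move=> h X Y; rewrite -scalemxAr -scalemxAl !mxtraceZ h. Qed.

Lemma tdual_fold I (r : seq I) (F G : I -> 'M[C]_n -> 'M[C]_n) :
  (forall i, tdual (F i) (G i)) ->
  tdual (fun X => foldl (fun Y i => F i Y) X r) (fun X => foldr G X r).
Proof.
move=> h; elim: r => [|i r IHr] //=.
exact: (tdual_comp IHr (h i)).
Qed.

Lemma tdual_iter p L L' : tdual L L' -> tdual (iter p L) (iter p L').
Proof.
move=> h; elim: p => [|p IHp] //= X Y.
by rewrite h IHp -iterSr.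
Qed.

Lemma tdual_sym L L' : tdual L L' -> tdual L' L.
Proof. by move=> h X Y; rewrite mxtrace_mulC -h mxtrace_mulC. Qed.

(** The form of the dual iterate at [v] is the trace of [Y] against the iterate of [L] at the
    rank-one matrix [v *m mxadj v], which is positive definite by assumption. *)
Lemma improving_tdual L L' : posmap L' -> tdual L L' -> improving L -> improving L'.
Proof.
move=> pL' h [p hp]; exists p => Y pY Y0.
have [[hA _]] : psd (iter p L' Y) by have [_] := posmap_iter p pL'; apply.
split=> // v v0; rewrite qform_trace -(tdual_iter p h).
have pv : psd (v *m mxadj v) by have := psd_gram (mxadj v); rewrite mxadjK.
apply: psd_posdef_trace_gt0 => //; apply: hp => //.
apply: contraNneq v0 => vv0; apply/eqP/sqnorm_eq0.
by rewrite -trace_mx11 mxtrace_mulC vv0 mxtrace0.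
Qed.

(** If the form of the p-th iterate of X = [mxadj B *m B] vanishes at [v], then [B] kills [v]
    transformed by the adjoint of every Kraus word of length p. These words span all matrices, so
    [B], and hence X, is zero. *)
Lemma primitive_improving L : primitive L -> improving L.
Proof.
move=> [k [K [LE [p hp]]]].
have posL : posmap L.
  split=> [c X Y|X pX]; last by rewrite LE; apply: psd_sum => i _; apply: psd_conjV.
  rewrite !LE scaler_sumr -big_split; apply: eq_bigr => i _.
  by rewrite mulmxDr mulmxDl -scalemxAr -scalemxAl.
exists p => X pX X0.
have [_ posLp] := posmap_iter p posL.
have psdL := posLp _ pX; have [sa _] := psdL.
have [B XE] := psd_gramP pX.
(* Induction on [q]: a vanishing sum of nonnegative terms vanishes term by term, so the previous
   iterate has zero form at the image of [v] under the adjoint of each Kraus operator. *)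
have key q v : qform (iter q L X) v = 0 ->
    forall w : q.-tuple 'I_k, B *m mxadj (\prod_(i <- w) K i) *m v = 0.
  elim: q v => [|q IHq] v /=.
    move=> hv w; rewrite tuple0 big_nil mxadj1 mulmx1; apply: sqnorm_eq0.
    by rewrite -qform_gram -XE.
  rewrite LE {1}/qform mulmx_sumr mulmx_suml summxE => hv w.
  rewrite (tuple_eta w) big_cons.
  have hq i : 0 <= (mxadj v *m (K i *m iter q L X *m mxadj (K i)) *m v) 0 0.
    rewrite -/(qform _ _); have [_] := psd_conjV (K i) (proj2 (posmap_iter q posL) _ pX).
    exact.
  have := @psumr_eq0P _ _ _ _ (fun i _ => hq i) hv (thead w) isT.
  rewrite -/(qform _ _) -{1}[K (thead w)]mxadjK qform_conj => /IHq/(_ (behead_tuple w)) <-.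
  by rewrite -[in LHS]/(_ *m _) mxadjM !mulmxA.
split=> // v v0; rewrite lt_def andbC; have [_ -> /=] := psdL.
apply/eqP => hv; have {}key := key p v hv.
have all0 (Y : 'M[C]_n) : B *m mxadj Y *m v = 0.
  have [c ->] := hp Y; rewrite mxadj_sum mulmx_sumr mulmx_suml big1 // => w _.
  by rewrite mxadjZ -scalemxAr -scalemxAl key scaler0.
move/eqP: X0; apply; rewrite XE.
suff -> : B = 0 by rewrite mulmx0.
have [i vi] := cV_neq0_ex v0.
apply/matrixP => a b; rewrite [RHS]mxE.
(* A matrix unit sends [v] to [v i] times a basis vector, which isolates the entry [B a b] times the
   nonzero [v i]. *)
have := all0 (mxadj (delta_mx b i)); rewrite mxadjK -mulmxA => /matrixP/(_ a 0).
rewrite [RHS]mxE mxE (bigD1 b) //= big1 => [|j jb]; last first.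
  rewrite mxE big1 ?mulr0 // => l _; rewrite !mxE (negPf jb) mul0r //.
rewrite addr0 mxE (bigD1 i) //= big1 => [|j ji]; last first.
  by rewrite !mxE (negPf ji) andbF mul0r.
rewrite addr0 mxE !eqxx mul1r => /eqP; rewrite mulf_eq0 (negPf vi) orbF.
by move/eqP.
Qed.

End PositiveMaps.

(** * Perron-Frobenius eigenvectors of improving maps *)

Section ComplexContinuity.
Variable R : realType.
Local Notation C := R[i].
Variable T : topologicalType.
Implicit Types f g : T -> C.

(** Working with the two real coordinates keeps all topology in real spaces, where the compactness
    argument takes place. *)
Definition ccont f : Prop :=
  continuous (fun x => complex.Re (f x)) /\ continuous (fun x => complex.Im (f x)).

Lemma ccont_cst c : ccont (fun=> c).
Proof. by split; apply: cst_continuous. Qed.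

Lemma ccont_real (f : T -> R) : continuous f -> ccont (fun x => (f x)%:C).
Proof. by move=> h; split=> //; apply: cst_continuous. Qed.

Lemma ccont_eq f g : f =1 g -> ccont f -> ccont g.
Proof. by move=> /funext ->. Qed.

Lemma ccontD f g : ccont f -> ccont g -> ccont (fun x => f x + g x).
Proof.
move=> [f1 f2] [g1 g2]; split=> x.
  rewrite (_ : (fun x => _) = (fun x => complex.Re (f x) + complex.Re (g x))).
    by apply: cvgD; [apply: f1 | apply: g1].
  by apply/funext => y; case: (f y) (g y) => a b [].
rewrite (_ : (fun x => _) = (fun x => complex.Im (f x) + complex.Im (g x))).
  by apply: cvgD; [apply: f2 | apply: g2].
by apply/funext => y; case: (f y) (g y) => a b [].
Qed.

Lemma ccontM f g : ccont f -> ccont g -> ccont (fun x => f x * g x).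
Proof.
move=> [f1 f2] [g1 g2]; split=> x.
  rewrite (_ : (fun x => _) = (fun x => complex.Re (f x) * complex.Re (g x) +
      - (complex.Im (f x) * complex.Im (g x)))).
    apply: cvgD; last apply: cvgN; apply: cvgM;
      by [apply: f1 | apply: g1 | apply: f2 | apply: g2].
  by apply/funext => y; case: (f y) (g y) => a b [].
rewrite (_ : (fun x => _) = (fun x => complex.Re (f x) * complex.Im (g x) +
      complex.Im (f x) * complex.Re (g x))).
  by apply: cvgD; apply: cvgM; by [apply: f1 | apply: g1 | apply: f2 | apply: g2].
by apply/funext => y; case: (f y) (g y) => a b [].
Qed.

Lemma ccont_conj f : ccont f -> ccont (fun x => conjc (f x)).
Proof.
move=> [f1 f2]; split=> x.
  rewrite (_ : (fun x => _) = (fun x => complex.Re (f x))); first exact: f1.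
  by apply/funext => y; case: (f y).
rewrite (_ : (fun x => _) = (fun x => - complex.Im (f x))).
  by apply: cvgN; apply: f2.
by apply/funext => y; case: (f y).
Qed.

Lemma ccontB f g : ccont f -> ccont g -> ccont (fun x => f x - g x).
Proof.
move=> hf hg; apply: (@ccont_eq (fun x => f x + (-1) * g x)).
  by move=> x; rewrite mulN1r.
by apply: ccontD => //; apply: ccontM => //; apply: ccont_cst.
Qed.

Lemma ccont_sum I (r : seq I) (F : I -> T -> C) :
  (forall i, ccont (F i)) -> ccont (fun x => \sum_(i <- r) F i x).
Proof.
move=> h; elim: r => [|i r IHr].
  by apply: ccont_eq (ccont_cst 0) => x; rewrite big_nil.
by apply: ccont_eq (ccontD (h i) IHr) => x; rewrite big_cons.
Qed.

Lemma closed_preimage (f : T -> R) (D : set R) : continuous f -> closed D -> closed (f @^-1` D).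
Proof. by move=> cf cD; apply: preimage_closed => // x _; apply: cf. Qed.

Lemma ccont_closed_ge0 f : ccont f -> closed [set x | 0 <= f x].
Proof.
move=> [f1 f2].
rewrite (_ : [set x | _] = (fun x => complex.Re (f x)) @^-1` [set y | 0 <= y] `&`
   (fun x => complex.Im (f x)) @^-1` [set y | y = 0]).
  exact: closedI (closed_preimage f1 (@closed_ge _ 0)) (closed_preimage f2 (@closed_eq _ 0)).
apply/seteqP; split=> x /=; case: (f x) => a b; rewrite lecE /= => h.
  by case/andP: h => /eqP.
by case: h => h1 ->; rewrite eqxx.
Qed.

Lemma ccont_closed_eq0 f : ccont f -> closed [set x | f x = 0].
Proof.
move=> [f1 f2].
rewrite (_ : [set x | _] = (fun x => complex.Re (f x)) @^-1` [set y | y = 0] `&`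
   (fun x => complex.Im (f x)) @^-1` [set y | y = 0]).
  exact: closedI (closed_preimage f1 (@closed_eq _ 0)) (closed_preimage f2 (@closed_eq _ 0)).
apply/seteqP; split=> x /=; case: (f x) => a b /=; first by case=> -> ->.
by case=> -> ->.
Qed.

End ComplexContinuity.

Section EntryBounds.
Variable R : realType.
Local Notation C := R[i].

Lemma mul_conj_le (x y : C) : `|conjc x * y| <= x * conjc x + y * conjc y.
Proof.
have hx : x * conjc x = `|x| ^+ 2 by rewrite sqr_normc.
have hy : y * conjc y = `|y| ^+ 2 by rewrite sqr_normc.
rewrite hx hy normrM normcJ !normc_def -!rmorphXn -rmorphM -rmorphD /= lecR.
move: (Num.sqrt _) (Num.sqrt _) (sqrtr_ge0 (complex.Re x ^+ 2 + complex.Im x ^+ 2))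
  (sqrtr_ge0 (complex.Re y ^+ 2 + complex.Im y ^+ 2)) => a b a0 b0.
nra.
Qed.

(** An entry of a Gram matrix is an inner product of two columns, bounded by the sum of their
    squared norms; each of these is at most the trace, whence the factor 2. *)
Lemma psd_entry_le n (A : 'M[C]_n) i j : psd A -> `|A i j| <= 2%:R * \tr A.
Proof.
move=> /psd_gramP[B ->]; rewrite mxE mxtrace_gram.
apply: le_trans (ler_norm_sum _ _ _) _.
have hc l : \sum_k B k l * conjc (B k l) <= \sum_l \sum_k B k l * conjc (B k l).
  rewrite [leRHS](bigD1 l) //= lerDl; apply: sumr_ge0 => m _; apply: sumr_ge0 => k _.
  exact: mulcJ_ge0.
apply: le_trans (_ : _ <= \sum_k (B k i * conjc (B k i) + B k j * conjc (B k j))) _.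
  by apply: ler_sum => k _; rewrite mxadjE mul_conj_le.
by rewrite big_split mulr_natl mulr2n lerD.
Qed.

Lemma norm_Re_le (z : C) (b : R) : `|z| <= b%:C -> `|complex.Re z| <= b.
Proof. by move=> h; have := le_trans (normc_ge_Re z) h; rewrite lecR. Qed.

Lemma norm_Im_le (z : C) (b : R) : `|z| <= b%:C -> `|complex.Im z| <= b.
Proof.
move=> h; rewrite -normrN -ReiNIm; apply: norm_Re_le.
by rewrite normrM (_ : `|'i%C| = 1 :> C) ?mulr1 // normc_def /= expr0n expr1n add0r sqrtr1.
Qed.

Lemma psd_le_trace n (A : 'M[C]_n) : psd A -> psd ((\tr A) *: 1%:M - A).
Proof.
move=> pA; have [hA _] := pA; have [P [d [hP AE]]] := selfadjoint_udiag hA.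
have d0 i : 0 <= (d i)%:C by have := pA; rewrite AE => /(psd_udiag_inv hP)/(_ i).
rewrite scalemx1 {1}AE (mxtrace_udiag _ hP) -(udiag1 _ hP) AE udiagB; apply: psd_udiag => i.
by rewrite subr_ge0 (bigD1 i) //= lerDl sumr_ge0.
Qed.

End EntryBounds.

(** If [b < a], the bound gives 1 <= K (b / a)^q for all q, while the right side tends to 0. This
    compares growth rates without extracting roots. *)
Lemma geometric_le (R : realType) (a b K : R) : 0 <= a -> 0 <= b ->
  (forall q, a ^+ q <= K * b ^+ q) -> a <= b.
Proof.
move=> a0 b0 h; rewrite leNgt; apply/negP => ba.
have a_gt0 : 0 < a by apply: le_lt_trans ba.
have hq q : 1 <= K * (b / a) ^+ q.
  by rewrite expr_div_n mulrA ler_pdivlMr ?exprn_gt0 // mul1r.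
have lt1 : `|b / a| < 1 by rewrite ger0_norm ?divr_ge0 // ltr_pdivrMr // mul1r.
have hc : (fun q => K * (b / a) ^+ q) @ \oo --> (0 : R).
  by rewrite -(mulr0 K); apply: cvgM; [exact: cvg_cst | exact: cvg_expr lt1].
suff : (1 : R) <= 0 by rewrite ler10.
by rewrite -(cvg_lim _ hc) //; apply: limr_ge; [exact: cvgP hc | apply: nearW].
Qed.

Lemma posdef_neq0 (R : realType) n (A : 'M[R[i]]_n) : (0 < n)%N -> posdef A -> A != 0.
Proof.
move=> n0 [_ pA]; have v0 : delta_mx (Ordinal n0) 0 != 0 :> 'cV[R[i]]_n.
  apply/eqP => /matrixP/(_ (Ordinal n0) 0)/eqP.
  by rewrite !mxE !eqxx oner_eq0.
apply: contraTneq (pA _ v0) => ->.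
by rewrite /qform mulmx0 mul0mx mxE ltxx.
Qed.

Lemma mxtraceB (R : pzRingType) n (A B : 'M[R]_n) : \tr (A - B) = \tr A - \tr B.
Proof. exact: raddfB. Qed.

Section PerronFrobenius.
Variable R : realType.
Variable n : nat.
Hypothesis n_gt0 : (0 < n)%N.
Local Notation C := R[i].
Variable L : 'M[C]_n -> 'M[C]_n.
Hypothesis posL : posmap L.

(* Real coordinates of a pair (t, X): [None] indexes t, [Some (true, _)] and [Some (false, _)] the
   real and imaginary parts of the entries of X. *)
Let coord : finType := option (bool * ('I_n * 'I_n)).
Let m := #|{: coord}|.
Let tco (x : 'rV[R]_m) : R := x ord0 (enum_rank (None : coord)).
Let mco (x : 'rV[R]_m) : 'M[C]_n := \matrix_(a, b)
  Complex (x ord0 (enum_rank (Some (true, (a, b)) : coord)))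
          (x ord0 (enum_rank (Some (false, (a, b)) : coord))).

Let enc (t : R) (X : 'M[C]_n) : 'rV[R]_m := \row_k
  match (enum_val k : coord) with
  | None => t
  | Some (true, (a, b)) => complex.Re (X a b)
  | Some (false, (a, b)) => complex.Im (X a b)
  end.

Let tco_enc t X : tco (enc t X) = t.
Proof. by rewrite /tco mxE enum_rankK. Qed.

Let mco_enc t X : mco (enc t X) = X.
Proof.
by apply/matrixP => a b; rewrite !mxE !enum_rankK; case: (X a b).
Qed.

Let ccont_t : ccont (fun x => (tco x)%:C).
Proof. by apply: ccont_real => x; apply: coord_continuous. Qed.

Let ccont_m a b : ccont (fun x => mco x a b).
Proof.
split=> x.
  rewrite (_ : (fun x => _) = (fun x : 'rV[R]_m => x ord0 (enum_rank (Some (true, (a, b)) : coord)))).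
    exact: coord_continuous.
  by apply/funext => y; rewrite mxE.
rewrite (_ : (fun x => _) = (fun x : 'rV[R]_m => x ord0 (enum_rank (Some (false, (a, b)) : coord)))).
  exact: coord_continuous.
by apply/funext => y; rewrite mxE.
Qed.

Let ccont_L i j : ccont (fun x => L (mco x) i j).
Proof.
have [lL _] := posL.
apply: (@ccont_eq _ _ (fun x => \sum_a \sum_b mco x a b * L (delta_mx a b) i j)).
  move=> x; rewrite [in RHS](matrix_sum_delta (mco x)) (linmap_sum _ _ lL) summxE.
  apply: eq_bigr => a _; rewrite (linmap_sum _ _ lL) summxE; apply: eq_bigr => b _.
  by rewrite (linmapZ _ _ lL) [RHS]mxE.
apply: ccont_sum => a; apply: ccont_sum => b.
by apply: ccontM; [exact: ccont_m | exact: ccont_cst].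
Qed.

Let ccont_qform (F : 'rV[R]_m -> 'M[C]_n) v :
  (forall i j, ccont (fun x => F x i j)) -> ccont (fun x => qform (F x) v).
Proof.
move=> h; apply: (@ccont_eq _ _ (fun x => \sum_j (\sum_i conjc (v i 0) * F x i j) * v j 0)).
  move=> x; rewrite /qform mxE; apply: eq_bigr => j _; rewrite mxE; congr (_ * _).
  by apply: eq_bigr => i _; rewrite mxadjE.
apply: ccont_sum => j; apply: ccontM; last exact: ccont_cst.
by apply: ccont_sum => i; apply: ccontM; [exact: ccont_cst | exact: h].
Qed.

Let closed_psd (F : 'rV[R]_m -> 'M[C]_n) :
  (forall i j, ccont (fun x => F x i j)) -> closed [set x | psd (F x)].
Proof.
move=> h.
rewrite (_ : [set x | _] =
   \bigcap_(p in [set: 'I_n * 'I_n]) [set x | conjc (F x p.2 p.1) - F x p.1 p.2 = 0] `&`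
   \bigcap_(v in [set: 'cV[C]_n]) [set x | 0 <= qform (F x) v]).
  apply: closedI; apply: closed_bigI => p _.
    by apply: ccont_closed_eq0; apply: ccontB => //; apply: ccont_conj.
  by apply: ccont_closed_ge0; apply: ccont_qform.
apply/seteqP; split=> x /=.
  rewrite psdE => -[sa ge0]; split=> [[a b] _ /=|v _]; last exact: ge0.
  by rewrite -mxadjE sa subrr.
move=> [sa ge0]; rewrite psdE; split=> [|v]; last exact: ge0.
by apply/matrixP => a b; rewrite mxadjE; apply/eqP; rewrite -subr_eq0; apply/eqP/(sa (a, b)).
Qed.

(** Keeping t as a coordinate replaces the Collatz-Wielandt number, merely semicontinuous in X, by a
    continuous projection to be maximised. *)
Let feasible : set 'rV[R]_m :=
  [set x | psd (mco x)] `&` [set x | \tr (mco x) - 1 = 0] `&` [set x | 0 <= (tco x)%:C]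
  `&` [set x | psd (L (mco x) - (tco x)%:C *: mco x)].

Let T := complex.Re (\tr (L 1%:M)).

(** A state satisfies X <= 1, so t = t Tr X <= Tr L(X) <= Tr L(1). *)
Let feasible_t x : feasible x -> tco x <= T.
Proof.
have [lL pL] := posL.
move=> [[[pX /= trX] t0] pLX].
have pX1 : psd (1%:M - mco x).
  by have := psd_le_trace pX; rewrite (eqP (_ : \tr (mco x) == 1)) ?scale1r // -subr_eq0 trX.
have h1 := psd_trace_ge0 (pL _ pX1).
have h2 := psd_trace_ge0 pLX.
have := addr_ge0 h1 h2; rewrite (linmapB _ _ lL) !mxtraceB mxtraceZ.
have -> : \tr (mco x) = 1 by apply/eqP; rewrite -subr_eq0 trX.
rewrite mulr1 addrA subrK subr_ge0 /T.
by case: (\tr (L _)) => a b; rewrite lecE /= => /andP[].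
Qed.

(** Entries of a state are bounded by 2 and t by [T]; the sum serves as one bound for all
    coordinates. *)
Let feasible_box x : feasible x -> forall i, - (2 + T) <= x ord0 i <= 2 + T.
Proof.
have [lL pL] := posL.
move=> fx i; have := feasible_t fx; move: fx => [[[pX /= trX]]]; rewrite ler0c => t0 _ tT.
have T0 : 0 <= T by apply: le_trans tT.
have tr1 : \tr (mco x) = 1 by apply/eqP; rewrite -subr_eq0 trX.
have hM a b : `|mco x a b| <= (2%:R : R)%:C.
  by apply: le_trans (psd_entry_le a b pX) _; rewrite tr1 mulr1 rmorph_nat.
rewrite -ler_norml -(enum_valK i).
case: (enum_val i) => [[[] [a b]]|].
- have := norm_Re_le (hM a b); rewrite mxE /= => h.
  by apply: le_trans h _; rewrite lerDl.
- have := norm_Im_le (hM a b); rewrite mxE /= => h.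
  by apply: le_trans h _; rewrite lerDl.
- by rewrite -/(tco x) ger0_norm // (le_trans tT) // lerDr.
Qed.

Let feasible_compact : compact feasible.
Proof.
apply: (@subclosed_compact _ _ [set v : 'rV[R]_m | forall i, `[- (2 + T), 2 + T]%classic (v ord0 i)]).
- apply: closedI; first apply: closedI; first apply: closedI.
  + exact: closed_psd ccont_m.
  + apply: ccont_closed_eq0; apply: ccontB; last exact: ccont_cst.
    by apply: ccont_sum => i; exact: ccont_m.
  + exact: ccont_closed_ge0 ccont_t.
  + apply: closed_psd => i j.
    apply: (@ccont_eq _ _ (fun x => L (mco x) i j - (tco x)%:C * mco x i j)).
      by move=> x; rewrite [RHS]mxE [X in _ = _ + X]mxE [X in _ = _ - X]mxE.
    by apply: ccontB => //; apply: ccontM.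
- apply: (@rV_compact R m (fun=> `[- (2 + T), 2 + T]%classic)) => i.
  exact: segment_compact.
- by move=> x fx i /=; rewrite in_itv /=; apply: feasible_box.
Qed.

(** The inequality is homogeneous in X, so dividing by the trace produces a state with the same
    t. *)
Let feasible_enc (t : R) X : 0 <= t -> psd X -> X != 0 ->
  psd (L X - t%:C *: X) -> exists2 x, feasible x & tco x = t.
Proof.
have [lL _] := posL.
move=> t0 pX X0 hX; have tX := psd_trace_gt0 pX X0.
exists (enc t ((\tr X)^-1 *: X)); last exact: tco_enc.
rewrite /feasible /= mco_enc tco_enc; split; first split; first split.
- by apply: psdZ => //; rewrite invr_ge0 ltW.
- by rewrite mxtraceZ mulVf ?subrr // gt_eqF.
- by rewrite /= ler0c.
- rewrite /= (linmapZ _ _ lL) scalerA mulrC -scalerA -scalerBr; apply: psdZ => //.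
  by rewrite invr_ge0 ltW.
Qed.

(* Collatz-Wielandt: maximise t subject to L X >= t X over states X. If L X - t X were nonzero at
   the maximum, an improving power of L would allow a larger t. *)
Lemma perron_eigenvector : improving L ->
  exists (X : 'M[C]_n) (r : R), [/\ posdef X, 0 <= r & L X = r%:C *: X].
Proof.
have [lL pL] := posL.
move=> [p hp].
have one0 : (1%:M : 'M[C]_n) != 0.
  by apply/eqP => /matrixP/(_ (Ordinal n_gt0) (Ordinal n_gt0))/eqP; rewrite !mxE eqxx oner_eq0.
have fne : feasible !=set0.
  have [||||x fx _] := @feasible_enc 0 1%:M; rewrite ?scale0r ?subr0 //.
  - exact: psd1.
  - exact/pL/psd1.
  - by exists x.
have [x xf xmax] := compact_EVT_max fne feasible_compact
  (continuous_subspaceT (fun y => @coord_continuous _ _ _ ord0 (enum_rank (None : coord)) y)).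
rewrite inE in xf.
have {}xmax y : feasible y -> tco y <= tco x by move=> fy; apply: xmax; rewrite inE.
move: (xf) => [[[/= pX trX]]]; rewrite ler0c => t0 pLX.
have X0 : mco x != 0.
  by apply/eqP => h; move: trX; rewrite h mxtrace0 sub0r => /eqP; rewrite oppr_eq0 oner_eq0.
have LX : L (mco x) = (tco x)%:C *: mco x.
  apply/eqP; rewrite -subr_eq0; apply: contraT => nz.
  have pd1 := hp _ pLX nz; have pdZ := hp _ pX X0.
  have [lLp pLp] := posmap_iter p posL.
  (* The p-th iterate of L X - t X is at least c times that of X; since L commutes with its
     iterates, this says that t + c is feasible with the iterate of X. *)
  have [c c0 hc] := posdef_dominates pd1 (proj1 pdZ).
  set Z := iter p L (mco x) in pdZ hc.
  have Z0 : Z != 0 by apply: posdef_neq0.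
  have [||||y fy ty] := @feasible_enc (tco x + c) Z.
  - by rewrite addr_ge0 // ltW.
  - exact: posdef_psd.
  - exact: Z0.
  - move: hc; rewrite (linmapB _ _ lLp) (linmapZ _ _ lLp) -/Z -iterSr /= -/Z.
    by rewrite rmorphD scalerDl opprD addrA.
  by have := xmax _ fy; rewrite ty gerDl leNgt c0.
exists (mco x), (tco x); split=> //.
(* The p-th iterate of X is both positive definite and a nonnegative multiple of X, which forces X
   itself to be positive definite. *)
have Lp q : iter q L (mco x) = (tco x ^+ q)%:C *: mco x.
  elim: q => [|q IHq] /=; first by rewrite expr0 scale1r.
  by rewrite IHq (linmapZ _ _ lL) LX scalerA exprSr rmorphM.
have [sa pd] := hp _ pX X0; split=> [|v v0]; first by have [] := pX.
have [_ /(_ v)] := pX; rewrite -/(qform _ _) => ge0.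
have := pd v v0; rewrite Lp qformZ lt_def mulf_eq0 negb_or => /andP[/andP[_ h] _].
by rewrite lt_def h.
Qed.

Section Eigenvector.
Variables (X : 'M[C]_n) (r : R).
Hypotheses (pdX : posdef X) (r0 : 0 <= r) (LX : L X = r%:C *: X).

Lemma iter_perron q : iter q L X = (r ^+ q)%:C *: X.
Proof.
have [lL _] := posL.
elim: q => [|q IHq] /=; first by rewrite expr0 scale1r.
by rewrite IHq (linmapZ _ _ lL) LX scalerA exprSr rmorphM.
Qed.


Let bounded_orbit Y := exists K : R, forall q i j, `|iter q L Y i j| <= (K * r ^+ q)%:C.

(** c Z <= X is preserved by the iterates, and X is scaled by r^q; the trace then controls every
    entry. *)
Let bounded_orbit_psd Z : psd Z -> bounded_orbit Z.
Proof.
move=> pZ; have [c c0 hc] := posdef_dominates pdX (proj1 pZ).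
have tX : (complex.Re (\tr X))%:C = \tr X.
  by apply/RRe_real/ger0_real/psd_trace_ge0/posdef_psd.
exists (2 * (c^-1 * complex.Re (\tr X))) => q i j.
have [lLq pLq] := posmap_iter q posL.
apply: le_trans (psd_entry_le i j (pLq _ pZ)) _.
rewrite -mulrA rmorphM rmorph_nat /= ler_pM2l ?ltr0n //.
have := psd_trace_ge0 (pLq _ hc).
rewrite (linmapB _ _ lLq) (linmapZ _ _ lLq) iter_perron mxtraceB !mxtraceZ subr_ge0.
rewrite -tX -rmorphM => h; have c0C : 0 < c%:C by rewrite ltcR.
rewrite -(ler_pM2l c0C) -rmorphM; apply: le_trans h _.
by rewrite lecR -[c^-1 * _ * _]mulrA mulVKf ?gt_eqF // mulrC.
Qed.

Let bounded_orbitD Y Z : bounded_orbit Y -> bounded_orbit Z -> bounded_orbit (Y + Z).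
Proof.
move=> [a ha] [b hb]; exists (a + b) => q i j; have [lLq _] := posmap_iter q posL.
rewrite (linmapD _ _ lLq) mxE mulrDl rmorphD /=.
by apply: le_trans (ler_normD _ _) _; apply: lerD.
Qed.

Let bounded_orbitZ c Y : bounded_orbit Y -> bounded_orbit (c *: Y).
Proof.
move=> [a ha]; exists (Normc.normc c * a) => q i j; have [lLq _] := posmap_iter q posL.
rewrite (linmapZ _ _ lLq) mxE normrM -mulrA rmorphM /=.
by apply: ler_wpM2l; [exact: normr_ge0 | exact: ha].
Qed.

Let bounded_orbit_selfadjoint Y : selfadjoint Y -> bounded_orbit Y.
Proof.
move=> sY; have [c c0 hc] := selfadjoint_upper sY.
have -> : Y = c%:C *: 1%:M + (-1) *: (c%:C *: 1%:M - Y).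
  by rewrite scaleN1r opprB addrC subrK.
apply: bounded_orbitD; last exact/bounded_orbitZ/bounded_orbit_psd.
exact/bounded_orbitZ/bounded_orbit_psd/psd1.
Qed.

(** The Cartesian decomposition into self-adjoint parts, each a combination of positive semidefinite
    matrices, extends the orbit bound from the cone to all matrices. *)
Lemma iter_entry_bound Y :
  exists K : R, forall q i j, `|iter q L Y i j| <= (K * r ^+ q)%:C.
Proof.
have -> : Y = 2%:R^-1 *: (Y + mxadj Y) + (- 'i%C / 2%:R) *: ('i%C *: (Y - mxadj Y)).
  rewrite scalerA mulrAC mulNr -expr2 sqr_i opprK mul1r -scalerDr addrACA subrr addr0.
  by rewrite -mulr2n -[Y *+ 2]scaler_nat scalerA mulVf ?scale1r // pnatr_eq0.
apply: bounded_orbitD; apply: bounded_orbitZ; apply: bounded_orbit_selfadjoint.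
  by rewrite /selfadjoint mxadjD mxadjK addrC.
rewrite /selfadjoint mxadjZ mxadjB mxadjK -opprB scalerN -scaleNr; congr (_ *: _).
by apply/eqP; rewrite eq_complex /= oppr0 opprK !eqxx.
Qed.

(** [X] shows that r is attained. For any other eigenpair z, Y, a nonzero entry of Y has orbit |z|^q
    times its modulus, bounded by a multiple of r^q, so |z| <= r. *)
Lemma specrad_perron : specrad L = r.
Proof.
have X0 := posdef_neq0 n_gt0 pdX.
rewrite /specrad; set S := [set _ | _ in _].
have Sr : S r.
  exists r%:C; first by exists X.
  by rewrite /= expr0n addr0 sqrtr_sqr ger0_norm.
have ubS : ubound S r.
  move=> _ [z [Y [Y0 LY]] <-].
  have [K hK] := iter_entry_bound Y.
  have [lL _] := posL.
  have itY q : iter q L Y = z ^+ q *: Y.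
    elim: q => [|q IHq] /=; first by rewrite expr0 scale1r.
    by rewrite IHq (linmapZ _ _ lL) LY scalerA exprSr.
  have [[a b] Yab] : exists p, Y p.1 p.2 != 0.
    apply/existsP; apply: contraNT Y0 => /existsPn h; apply/eqP/matrixP => a b.
    by rewrite [RHS]mxE; apply/eqP/negPn; have := h (a, b).
  have nY : 0 < Normc.normc (Y a b).
    by rewrite -ltcR -[X in _ < X]/(`|Y a b|) normr_gt0.
  apply: (@geometric_le _ _ _ (K / Normc.normc (Y a b))) => // [|q].
    by rewrite -ler0c -[X in _ <= X]/(`|z|).
  have := hK q a b; rewrite itY mxE normrM normrX.
  rewrite -[`|z|]/((Normc.normc z)%:C) -[`|Y a b|]/((Normc.normc (Y a b))%:C).
  by rewrite -rmorphXn -rmorphM /= lecR mulrAC ler_pdivlMr.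
apply/eqP; rewrite eq_le; apply/andP; split.
  by apply: ge_sup => //; exists r.
by apply: ub_le_sup => //; exists r.
Qed.

Lemma trace_orbit_bounds rho : is_state rho ->
  exists c K : R, [/\ 0 < c, 0 < K &
    forall q, c * r ^+ q <= complex.Re (\tr (rho *m iter q L 1%:M)) <= K * r ^+ q].
Proof.
move=> [prho trho].
have rho0 : rho != 0.
  by apply/eqP => h; move: trho; rewrite h mxtrace0 => /esym/eqP; rewrite oner_eq0.
have t0 := psd_posdef_trace_gt0 prho rho0 pdX.
have tE : (complex.Re (\tr (rho *m X)))%:C = \tr (rho *m X).
  exact/RRe_real/ger0_real/ltW.
have t0' : 0 < complex.Re (\tr (rho *m X)) by rewrite -ltcR tE.
have pd1 : posdef (1%:M : 'M[C]_n) := posdef1 R n.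
have [a a0 ha] := posdef_dominates pd1 (proj1 pdX).
have [b b0 hb] := posdef_dominates pdX (proj1 pd1).
exists (a * complex.Re (\tr (rho *m X))), (b^-1 * complex.Re (\tr (rho *m X))).
split=> [||q]; [by rewrite mulr_gt0 | by rewrite mulr_gt0 // invr_gt0 |].
have [lLq pLq] := posmap_iter q posL.
have := psd_mul_trace_ge0 prho (pLq _ ha).
have := psd_mul_trace_ge0 prho (pLq _ hb).
rewrite !(linmapB _ _ lLq) !(linmapZ _ _ lLq) iter_perron !mulmxBr !mxtraceB.
rewrite -!scalemxAr !mxtraceZ !subr_ge0 -tE.
case: (\tr (rho *m iter q L 1%:M)) => u v; rewrite -!rmorphM /= !lecE /=.
rewrite !(mul0r, mulr0, add0r, addr0, subr0) => /andP[_ h1] /andP[_ h2].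
apply/andP; split; first by rewrite mulrAC -mulrA.
by rewrite mulrAC -mulrA mulrC ler_pdivlMr // mulrC.
Qed.

Lemma trace_orbit_root_cvg rho : is_state rho ->
  (fun q : nat => powR (complex.Re (\tr (rho *m iter q L 1%:M))) (q%:R)^-1) @ \oo --> r.
Proof.
move=> /trace_orbit_bounds[c [K [c0 K0 h]]].
have root_cvg (u : R) : 0 < u ->
    (fun q : nat => powR (u * r ^+ q.+1) (q.+1%:R)^-1) @ \oo --> r.
  move=> u0.
  rewrite (_ : (fun q => _) = (fun q : nat => expR ((q.+1%:R)^-1 * ln u) * r)); last first.
    apply/funext => q; rewrite powRM ?exprn_ge0 //; last exact: ltW.
    rewrite -(powR_mulrn q.+1 r0) -powRrM.
    by rewrite mulfV ?pnatr_eq0 // powRr1 // /powR gt_eqF.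
  suff : (fun q : nat => expR ((q.+1%:R)^-1 * ln u) * r) @ \oo --> expR (0 * ln u) * r.
    by rewrite mul0r expR0 mul1r.
  apply: cvgM; last exact: cvg_cst.
  apply: continuous_cvg; first exact: continuous_expR.
  by apply: cvgM; [exact: cvg_harmonic | exact: cvg_cst].
(* The shift discards index 0, where the exponent is the inverse of 0, that is 0 by convention. *)
rewrite -cvg_shiftS /=.
apply: (squeeze_cvgr _ (root_cvg c c0) (root_cvg K K0)).
apply: nearW => q /=; have /andP[h1 h2] := h q.+1.
have c1 : 0 <= c * r ^+ q.+1 by rewrite mulr_ge0 ?exprn_ge0 // ltW.
apply/andP; split; apply: ge0_ler_powR => //; rewrite ?nnegrE ?invr_ge0 //.
- exact: le_trans h1.
- exact: le_trans h1.
- by rewrite mulr_ge0 ?exprn_ge0 // ltW.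
Qed.

End Eigenvector.
End PerronFrobenius.

(** * Full counting statistics as products of collision maps *)

Section DepFunSums.
Variables (I : finType) (T : I -> finType).
Local Notation F := {dffun forall i, T i}.

Definition upd (x : F) i (t : T i) : F := [ffun k : I => @eqtype.dfwith I (fun k => T k) x i t k].

Lemma upd_in (x : F) i (t : T i) : upd x t i = t.
Proof. by rewrite ffunE eqtype.dfwith_in. Qed.

Lemma upd_out (x : F) i (t : T i) k : k != i -> upd x t k = x k.
Proof. by move=> ki; rewrite ffunE eqtype.dfwith_out // eq_sym. Qed.

Lemma updK (x : F) i (t : T i) : upd (upd x t) (x i) = x.
Proof.
apply/ffunP => k; have [->|ki] := eqVneq k i; first by rewrite upd_in.
by rewrite !upd_out.
Qed.

Lemma upd_eq (x y : F) i : (forall k, k != i -> x k = y k) -> upd x (y i) = y.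
Proof.
move=> h; apply/ffunP => k; have [->|ki] := eqVneq k i; first by rewrite upd_in.
by rewrite upd_out // h.
Qed.

Lemma prod_nat_eq1 (R : comNzRingType) (P : pred I) (b : I -> bool) :
  \prod_(i | P i) (b i)%:R = [forall (i | P i), b i]%:R :> R.
Proof.
case: (boolP [forall (i | P i), b i]) => [/forallP h|/forallPn[k]].
  by rewrite big1 // => i Pi; have /implyP -> := h i.
rewrite negb_imply => /andP[Pk /negPf bk].
by rewrite (bigD1 k) //= bk mul0r.
Qed.

(** The deltas are the [others] factor of a lifted operator: they freeze all coordinates except [i],
    so composing lifted operators sums over one probe only. *)
Lemma sum_upd (R : comNzRingType) (i : I) (x : F) (G : F -> R) :
  \sum_(z : F) (\prod_(k | k != i) (z k == x k)%:R) * G z = \sum_(t : T i) G (upd x t).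
Proof.
under eq_bigr => z _ do rewrite prod_nat_eq1.
rewrite (bigID (fun z : F => [forall (k | k != i), z k == x k])) /= [X in _ + X]big1 ?addr0; last first.
  by move=> z /negPf ->; rewrite mul0r.
rewrite (reindex_onto (fun t : T i => upd x t) (fun z : F => z i)) /=; last first.
  by move=> z /forallP h; apply: upd_eq => k ki; have /implyP/(_ ki)/eqP := h k.
apply: eq_big => [t|t /andP[h _]]; last by rewrite h mul1r.
rewrite upd_in eqxx andbT; apply/forallP => k; apply/implyP => ki.
by rewrite upd_out.
Qed.

(* Stands in for Fubini without splitting off a factor of the dependent product. *)
Lemma sum_coord (V : nmodType) (i : I) (K : T i -> F -> V) :
  (forall t e (s : T i), K t (upd e s) = K t e) ->
  (\sum_(e : F) K (e i) e) *+ #|T i| = \sum_(t : T i) \sum_(e : F) K t e.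
Proof.
move=> h; rewrite exchange_big pair_big /=.
(* Exchanging [t] with the coordinate [i] of [e] is an involution of the index set. *)
rewrite (reindex (fun p : F * T i => (upd p.1 p.2, p.1 i))) /=; last first.
  by exists (fun p : F * T i => (upd p.1 p.2, p.1 i)) => -[e t] _ /=; rewrite updK upd_in.
rewrite -(pair_big xpredT xpredT (fun (e : F) (t : T i) => K (e i) (upd e t))) /= -sumrMnl.
by apply: eq_bigr => e _; under eq_bigr => t _ do rewrite h; rewrite sumr_const.
Qed.

End DepFunSums.

Section CProd.
Variables (R : pzRingType) (V : lmodType R) (X : eqType).

(** Distributivity: by linearity of the steps, the sum over all outcome histories is the composition
    of the sums over single outcomes. *)
Lemma sum_cprod (I : Type) (r : seq I) (ls : I -> seq X) (E : I -> X -> V -> V) (v : V) :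
  (forall i x, linear (E i x)) ->
  \sum_(s <- cprod [seq ls i | i <- r]) foldl (fun u p => E p.1 p.2 u) v (zip r s) =
  foldl (fun u i => \sum_(x <- ls i) E i x u) v r.
Proof.
move=> linE; elim: r v => [|i r IHr] v /=; first by rewrite big_seq1.
rewrite big_allpairs_dep /=; under eq_bigr => x _ do rewrite /= IHr.
have linS j : linear (fun u => \sum_(x <- ls j) E j x u).
  by move=> c u w; rewrite scaler_sumr -big_split; apply: eq_bigr => x _; apply: linE.
pose Fd u := foldl (fun u i => \sum_(x <- ls i) E i x u) u r.
have linF : linear Fd.
  rewrite /Fd; elim: (r) => [|j r' IH] c u w //=.
  by rewrite linS IH.
have F0 : Fd 0 = 0 by have := linF (-1) 0 0; rewrite scaler0 addr0 scaleN1r addNr.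
rewrite -/(Fd _); elim: (ls i) => [|x l IHl]; first by rewrite !big_nil F0.
by rewrite !big_cons IHl -[E i x v]scale1r linF !scale1r.
Qed.

Lemma size_cprod (ls : seq (seq X)) s : s \in cprod ls -> size s = size ls.
Proof.
elim: ls s => [|l ls IHl] s /=; first by rewrite inE => /eqP ->.
by case/allpairsP => -[x t] /= [_ /IHl <- ->].
Qed.

End CProd.

Section Operators.
Variable R : realType.
Local Notation C := R[i].
Variables (dS M : nat) (dE : 'I_M -> nat) (N : nat) (j : 'I_N -> 'I_M).
Local Notation TotJ := (Tot dS dE j).
Local Notation D := {dffun forall n : 'I_N, 'I_(dE (j n))}.

Lemma sum_Tot (V : nmodType) (G : TotJ -> V) :
  \sum_x G x = \sum_(a : 'I_dS) \sum_(e : D) G (a, e).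
Proof. by rewrite pair_big; apply: eq_bigr => -[]. Qed.

Lemma omulE (A B : op R TotJ) x y : omul A B x y = \sum_z A x z * B z y.
Proof. by []. Qed.

Lemma op_eqP (A B : op R TotJ) : (forall x y, A x y = B x y) -> A = B.
Proof. by move=> h; apply/funext => x; apply/funext => y. Qed.

Lemma liftE_SE n (A : 'M[C]_(dE (j n))) : liftE A = liftSE (1%:M *t A) :> op R TotJ.
Proof. by apply: op_eqP => x y; rewrite /liftE /liftSE tensmxE mxE. Qed.

Lemma others_sym n (x y : TotJ) : others R n x y = others R n y x.
Proof. by apply: eq_bigr => m _; rewrite eq_sym. Qed.

Lemma othersE n (x : TotJ) (a : 'I_dS) (z : D) :
  others R n (a, z) x = \prod_(m < N | m != n) (z m == x.2 m)%:R.
Proof. by []. Qed.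

Lemma omul_liftSE n (A B : 'M[C]_(dS * dE (j n))) :
  omul (liftSE A) (liftSE B) = liftSE (A *m B) :> op R TotJ.
Proof.
apply: op_eqP => x y; rewrite /omul sum_Tot [in RHS]/liftSE tensmx_mulE mulr_suml.
apply: eq_bigr => c _; rewrite mulr_suml.
under eq_bigr => z _ do rewrite /liftSE [others R n x _]others_sym othersE /=
  [A _ _ * _]mulrC -mulrA.
rewrite sum_upd; apply: eq_bigr => t _; rewrite upd_in mulrA; congr (_ * _).
by rewrite othersE; apply: eq_bigr => m mn; rewrite upd_out.
Qed.

Variable T : forall n : 'I_N, 'M[C]_(dS * dE (j n)).

(** The operator left on the system when the probe goes from basis state [e'] to basis state [e]. *)
Definition blk d1 d2 (A : 'M[C]_(d1 * d2)) (e e' : 'I_d2) : 'M[C]_d1 :=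
  \matrix_(a, a') A (mxtens_index (a, e)) (mxtens_index (a', e')).

(** The head of [r] is the earliest collision, hence the rightmost factor; [e'] is the initial and
    [e] the final probe configuration. *)
Fixpoint mprod (r : seq 'I_N) (e e' : D) : 'M[C]_dS :=
  if r is n :: r' then mprod r' e e' *m blk (T n) (e n) (e' n) else 1%:M.

Lemma mprod_updl (r : seq 'I_N) n (e e' : D) (t : 'I_(dE (j n))) :
  n \notin r -> mprod r (upd e t) e' = mprod r e e'.
Proof.
elim: r => [|m r IHr] //=; rewrite inE negb_or => /andP[nm nr].
by rewrite IHr // upd_out // eq_sym.
Qed.

Lemma mprod_updr (r : seq 'I_N) n (e e' : D) (t : 'I_(dE (j n))) :
  n \notin r -> mprod r e (upd e' t) = mprod r e e'.
Proof.
elim: r => [|m r IHr] //=; rewrite inE negb_or => /andP[nm nr].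
by rewrite IHr // upd_out // eq_sym.
Qed.

Fixpoint omul_seq (r : seq 'I_N) : op R TotJ :=
  if r is n :: r' then omul (omul_seq r') (liftSE (T n)) else @oid R TotJ.

Lemma big_omul_seq (r : seq 'I_N) :
  \big[(fun A B => omul B A) / @oid R TotJ]_(n <- r) liftSE (T n) = omul_seq r.
Proof. by elim: r => [|n r IHr]; rewrite ?big_nil // big_cons IHr. Qed.

(** Each probe collides at most once, so deltas determine every intermediate configuration: only
    system indices are summed, and the probes outside [r] stay frozen. *)
Lemma omul_seqE (r : seq 'I_N) (x y : TotJ) : uniq r ->
  omul_seq r x y =
  mprod r x.2 y.2 x.1 y.1 * \prod_(m < N | m \notin r) (x.2 m == y.2 m)%:R.
Proof.
elim: r x y => [|n r IHr] x y.
  move=> _; rewrite /= /oid /= mxE prod_nat_eq1 -natrM mulnb; congr (_ : bool)%:R.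
  apply/eqP/andP => [->|[/eqP h1 /forallP h2]].
    by split=> //; apply/forallP => m; rewrite eqxx implybT.
  case: x y h1 h2 => a e [b e'] /= -> h2; congr (_, _); apply/ffunP => m.
  exact/eqP/h2.
move=> /= /andP[nr ur]; rewrite omulE sum_Tot [in RHS]mxE mulr_suml.
apply: eq_bigr => c _.
under [LHS]eq_bigr => z _ do rewrite IHr // /liftSE othersE mulrA mulrC.
rewrite sum_upd [in RHS]mxE -[RHS]mulrA [in RHS]mulrCA.
transitivity (\sum_t (x.2 n == t)%:R * (T n (mxtens_index (c, t)) (mxtens_index (y.1, y.2 n)) *
   (mprod r x.2 y.2 x.1 c * \prod_(m < N | m \notin n :: r) (x.2 m == y.2 m)%:R))).
  apply: eq_bigr => t _; rewrite /= upd_in mprod_updr //.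
  have -> : \prod_(m < N | m \notin r) (x.2 m == upd y.2 t m)%:R =
      (x.2 n == t)%:R * \prod_(m < N | m \notin n :: r) (x.2 m == y.2 m)%:R :> C.
    rewrite (bigD1 n) //= upd_in; congr (_ * _).
    apply: eq_big => [m|m /andP[_ mn]]; first by rewrite inE negb_or andbC.
    by rewrite upd_out.
  by ring.
by rewrite sum_delta.
Qed.

End Operators.

Section TripleSums.
Variables (I : finType) (T : I -> finType).
Local Notation F := {dffun forall i, T i}.

(** [sum_coord] is applied to each of the three configurations, at the cost of one factor [#|T i|]
    each. *)
Lemma sum3_coord (V : nmodType) (i : I) (H : T i -> T i -> T i -> F -> F -> F -> V) :
  (forall t t' t'' e e' e'' (s : T i), H t t' t'' (upd e s) e' e'' = H t t' t'' e e' e'') ->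
  (forall t t' t'' e e' e'' (s : T i), H t t' t'' e (upd e' s) e'' = H t t' t'' e e' e'') ->
  (forall t t' t'' e e' e'' (s : T i), H t t' t'' e e' (upd e'' s) = H t t' t'' e e' e'') ->
  (\sum_(e : F) \sum_(e' : F) \sum_(e'' : F) H (e i) (e' i) (e'' i) e e' e'') *+ #|T i| ^ 3 =
  \sum_t \sum_(e : F) \sum_t' \sum_(e' : F) \sum_t'' \sum_(e'' : F) H t t' t'' e e' e''.
Proof.
move=> h1 h2 h3; rewrite !expnS expn0 muln1 !mulrnA.
have -> : (\sum_(e : F) \sum_(e' : F) \sum_(e'' : F)
    H (e i) (e' i) (e'' i) e e' e'') *+ #|T i| =
  \sum_(e : F) \sum_(e' : F) \sum_t'' \sum_(e'' : F) H (e i) (e' i) t'' e e' e''.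
  rewrite -sumrMnl; apply: eq_bigr => e _; rewrite -sumrMnl; apply: eq_bigr => e' _.
  by rewrite (sum_coord (K := fun t'' e'' => H (e i) (e' i) t'' e e' e'')).
have -> : (\sum_(e : F) \sum_(e' : F) \sum_t'' \sum_(e'' : F)
    H (e i) (e' i) t'' e e' e'') *+ #|T i| =
  \sum_(e : F) \sum_t' \sum_(e' : F) \sum_t'' \sum_(e'' : F) H (e i) t' t'' e e' e''.
  rewrite -sumrMnl; apply: eq_bigr => e _.
  rewrite (sum_coord
    (K := fun t' e' => \sum_t'' \sum_(e'' : F) H (e i) t' t'' e e' e'')) //.
  by move=> t' e' s; apply: eq_bigr => t'' _; apply: eq_bigr => e'' _; rewrite h2.
rewrite (sum_coord
  (K := fun t e => \sum_t' \sum_(e' : F) \sum_t'' \sum_(e'' : F) H t t' t'' e e' e'')) //.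
move=> t e s; apply: eq_bigr => t' _; apply: eq_bigr => e' _.
by apply: eq_bigr => t'' _; apply: eq_bigr => e'' _; rewrite h1.
Qed.

End TripleSums.

Lemma mulmxn_inj (K : numFieldType) m n k : (0 < k)%N ->
  injective (fun A : 'M[K]_(m, n) => A *+ k).
Proof.
move=> k0 A A' /=; rewrite -[A *+ k]scaler_nat -[A' *+ k]scaler_nat.
by apply: scalerI; rewrite pnatr_eq0 -lt0n.
Qed.

Section Collisions.
Variable R : realType.
Local Notation C := R[i].
Variables (dS M : nat) (dE : 'I_M -> nat) (N : nat) (j : 'I_N -> 'I_M).
Hypothesis dE_gt0 : forall k, (0 < dE k)%N.
Local Notation TotJ := (Tot dS dE j).
Local Notation D := {dffun forall n : 'I_N, 'I_(dE (j n))}.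
Variables (T : forall n : 'I_N, 'M[C]_(dS * dE (j n))) (B : forall n : 'I_N, 'M[C]_(dE (j n))).

Definition collide n (X : 'M[C]_dS) : 'M[C]_dS := ptr (T n *m (X *t B n) *m mxadj (T n)).

(** A Kraus-type expansion: [t] is the traced final probe state, while [t'] and [t''] run over the
    matrix entries of [B n]. *)
Lemma collide_blk n X :
  collide n X = \sum_t \sum_t' \sum_t''
    B n t' t'' *: (blk (T n) t t' *m X *m mxadj (blk (T n) t t'')).
Proof.
apply/matrixP => a a'; rewrite mxE summxE; apply: eq_bigr => t _.
rewrite tensmx_mulE summxE exchange_big /= [RHS](eq_bigr (fun t' => \sum_t''
   B n t' t'' * (blk (T n) t t' *m X *m mxadj (blk (T n) t t'')) a a')); last first.
  by move=> t' _; rewrite summxE; apply: eq_bigr => t'' _; rewrite mxE.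
rewrite [RHS]exchange_big; apply: eq_bigr => t'' _ /=.
under [RHS]eq_bigr => t' _ do rewrite mxE mulr_sumr.
rewrite [RHS]exchange_big; apply: eq_bigr => c'' _ /=.
rewrite tensmx_mulE exchange_big /= mulr_suml; apply: eq_bigr => t' _.
rewrite [in RHS]mxE !mulr_suml mulr_sumr; apply: eq_bigr => c _.
rewrite tensmxE !mxadjE !mxE; ring.
Qed.

(** The contribution of one pair of histories: [e'] and [e''] are the initial probe configurations
    on the left and right, and the trace forces the common final one [e]. *)
Definition path_weight (r : seq 'I_N) X (e e' e'' : D) : 'M[C]_dS :=
  (\prod_(n <- r) B n (e' n) (e'' n)) *: (mprod T r e e' *m X *m mxadj (mprod T r e e'')).

Lemma path_weight_cons n r X e e' e'' : path_weight (n :: r) X e e' e'' =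
  path_weight r (B n (e' n) (e'' n) *:
    (blk (T n) (e n) (e' n) *m X *m mxadj (blk (T n) (e n) (e'' n)))) e e' e''.
Proof.
rewrite /path_weight big_cons /= mxadjM -scalemxAr -scalemxAl scalerA mulrC.
by rewrite !mulmxA.
Qed.

Lemma path_weight_linear r e e' e'' : linear (fun X => path_weight r X e e' e'').
Proof.
move=> c X Y; rewrite /path_weight mulmxDr mulmxDl scalerDr -scalemxAr -scalemxAl.
by rewrite !scalerA mulrC.
Qed.

Lemma prod_upd (r : seq 'I_N) n (e : D) (t : 'I_(dE (j n))) (F : forall m, 'I_(dE (j m)) -> C) :
  n \notin r -> \prod_(m <- r) F m (upd e t m) = \prod_(m <- r) F m (e m).
Proof.
move=> nr; apply: eq_big_seq => m mr; rewrite upd_out //.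
by apply: contraNneq nr => <-.
Qed.

(** The weight ignores the probes outside [r], so its terms repeat. Cubes of cardinalities on both
    sides record this without division; they coincide when [r] lists all probes. *)
Lemma path_weight_sum (r : seq 'I_N) X : uniq r ->
  (\sum_(e : D) \sum_(e' : D) \sum_(e'' : D) path_weight r X e e' e'') *+ (\prod_(n <- r) dE (j n)) ^ 3 =
  foldl (fun X n => collide n X) X r *+ #|D| ^ 3.
Proof.
elim: r X => [|n r IHr] X /=.
  move=> _; rewrite big_nil exp1n mulr1n.
  under eq_bigr => e _ do under eq_bigr => e' _ do under eq_bigr => e'' _ do
    rewrite /path_weight big_nil /= mul1mx mxadj1 mulmx1 scale1r.
  by rewrite !sumr_const -!mulrnA !expnS expn0 muln1 mulnA.
move=> /andP[nr ur]; rewrite -(IHr _ ur) big_cons expnMn mulrnA.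
congr (GRing.natmul _ _).
under eq_bigr => e _ do under eq_bigr => e' _ do under eq_bigr => e'' _ do
  rewrite path_weight_cons.
pose K t t' t'' : 'M[C]_dS :=
  B n t' t'' *: (blk (T n) t t' *m X *m mxadj (blk (T n) t t'')).
rewrite -[X in _ *+ (X ^ 3)%N]card_ord.
rewrite (sum3_coord (H := fun t t' t'' e e' e'' => path_weight r (K t t' t'') e e' e'')).
- rewrite exchange_big; apply: eq_bigr => e _ /=.
  under eq_bigr => t _ do rewrite exchange_big /=.
  rewrite exchange_big; apply: eq_bigr => e' _ /=.
  under eq_bigr => t _ do under eq_bigr => t' _ do rewrite exchange_big /=.
  under eq_bigr => t _ do rewrite exchange_big /=.
  rewrite exchange_big; apply: eq_bigr => e'' _ /=.
  rewrite collide_blk (linmap_sum _ _ (path_weight_linear r e e' e'')).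
  apply: eq_bigr => t _; rewrite (linmap_sum _ _ (path_weight_linear r e e' e'')).
  by apply: eq_bigr => t' _; rewrite (linmap_sum _ _ (path_weight_linear r e e' e'')).
- by move=> t t' t'' e e' e'' s; rewrite /path_weight !mprod_updl.
- move=> t t' t'' e e' e'' s; rewrite /path_weight mprod_updr //.
  by rewrite (prod_upd e' s (fun m => (B m)^~ (e'' m)) nr).
- move=> t t' t'' e e' e'' s; rewrite /path_weight mprod_updr //.
  by rewrite (prod_upd e'' s (fun m => B m (e' m)) nr).
Qed.

Lemma card_probes : #|D| = (\prod_(n <- enum 'I_N) dE (j n))%N.
Proof.
rewrite card_dep_ffun foldrE big_map enumT; apply: eq_bigr => n _; exact: card_ord.
Qed.

Lemma path_weight_total X :
  \sum_(e : D) \sum_(e' : D) \sum_(e'' : D) path_weight (enum 'I_N) X e e' e'' =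
  foldl (fun X n => collide n X) X (enum 'I_N).
Proof.
have := path_weight_sum X (enum_uniq 'I_N); rewrite -card_probes.
by apply: mulmxn_inj; rewrite expn_gt0 card_probes prodn_gt0.
Qed.

Lemma otr_collisions (rho : 'M[C]_dS) :
  otr (omul (omul (omul_seq T (enum 'I_N))
     (fun x y : TotJ => rho x.1 y.1 * \prod_(n < N) B n (x.2 n) (y.2 n)))
     (oadj (omul_seq T (enum 'I_N)))) =
  \tr (foldl (fun X n => collide n X) rho (enum 'I_N)).
Proof.
rewrite -path_weight_total raddf_sum /otr sum_Tot exchange_big; apply: eq_bigr => e _ /=.
have UE (x y : TotJ) : omul_seq T (enum 'I_N) x y = mprod T (enum 'I_N) x.2 y.2 x.1 y.1.
  rewrite omul_seqE ?enum_uniq // big_pred0 ?mulr1 // => m; by rewrite mem_enum.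
transitivity (\sum_a \sum_(e'' : D) \sum_a'' \sum_(e' : D) \sum_a' mprod T (enum 'I_N) e e' a a' *
    (rho a' a'' * \prod_(n < N) B n (e' n) (e'' n)) * conjc (mprod T (enum 'I_N) e e'' a a'')).
  apply: eq_bigr => a _; rewrite /omul sum_Tot exchange_big; apply: eq_bigr => e'' _ /=.
  apply: eq_bigr => a'' _; rewrite /oadj UE /= sum_Tot exchange_big mulr_suml.
  apply: eq_bigr => e' _; rewrite mulr_suml; apply: eq_bigr => a' _.
  by rewrite UE.
rewrite [RHS]raddf_sum /=.
under [RHS]eq_bigr => e' _ do rewrite raddf_sum /=.
rewrite [RHS]exchange_big [LHS]exchange_big; apply: eq_bigr => e'' _ /=.
under [LHS]eq_bigr => a _ do rewrite exchange_big /=.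
rewrite [LHS]exchange_big; apply: eq_bigr => e' _ /=.
rewrite /path_weight mxtraceZ mulr_sumr; apply: eq_bigr => a _.
rewrite mxE mulr_sumr; apply: eq_bigr => a'' _.
rewrite mxE mulr_suml mulr_sumr; apply: eq_bigr => a' _.
rewrite mxadjE big_enum /=; ring.
Qed.

End Collisions.

(** * Gibbs states and the moment generating function *)

Section Gibbs.
Variable R : realType.
Local Notation C := R[i].

Lemma cexpD (x y : C) : cexp (x + y) = cexp x * cexp y.
Proof.
case: x y => a b [c d]; rewrite /cexp /= expRD cosD sinD rmorphM /=.
rewrite mulrACA; congr (_ * _); apply/eqP; rewrite eq_complex /=.
by apply/andP; split; apply/eqP => //; rewrite addrC [cos b * _]mulrC [sin b * _]mulrC.
Qed.

Lemma cexp_real (x : R) : cexp x%:C = (expR x)%:C.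
Proof. by rewrite /cexp /= cos0 sin0 -[X in _ * X]/(1%:C) mulr1. Qed.

Lemma cexp0 : cexp 0 = 1 :> C.
Proof. by rewrite -[X in cexp X](rmorph0 (real_complex R)) cexp_real expR0. Qed.

Lemma cexpN_sum I (r : seq I) (F : I -> C) :
  cexp (- \sum_(i <- r) F i) = \prod_(i <- r) cexp (- F i).
Proof.
elim: r => [|i r IHr]; first by rewrite !big_nil oppr0 cexp0.
by rewrite !big_cons opprD cexpD IHr.
Qed.

Lemma conjc_cexp (z : C) : conjc (cexp z) = cexp (conjc z).
Proof. by case: z => a b; rewrite /cexp rmorphM /= cosN sinN oppr0. Qed.

Lemma cexp_unimodular (z : C) : complex.Re z = 0 -> cexp z * conjc (cexp z) = 1.
Proof. by move=> z0; rewrite conjc_cexp -cexpD addcJ z0 mulr0 cexp0. Qed.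

(** The logarithm of the partition function. It makes the Gibbs eigenvalues pure exponentials, so
    powers and products act on exponents. *)
Definition free_energy n (b : R) (h : 'I_n -> R) : R := ln (\sum_i expR (- (b * h i))).

Lemma gibbs_udiag n (b : R) (P : 'M[C]_n) h : (0 < n)%N -> unitarymatrix P ->
  gibbs b (udiag P (fun i => (h i)%:C)) =
  udiag P (fun i => (expR (- (b * h i) - free_energy b h))%:C).
Proof.
move=> n0 hP.
have Z0 : 0 < \sum_i expR (- (b * h i)).
  rewrite (bigD1 (Ordinal n0)) //=; apply: ltr_pwDl; first exact: expR_gt0.
  by apply: sumr_ge0 => i _; exact: expR_ge0.
rewrite /gibbs mxfun_udiag // mxtrace_udiag // udiagZ; apply: eq_udiag => i.
have E k : cexp (- b%:C * (h k)%:C) = (expR (- (b * h k)))%:C.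
  by rewrite mulNr -rmorphM -rmorphN cexp_real.
under eq_bigr => k _ do rewrite E.
by rewrite E -rmorph_sum -fmorphV -rmorphM /= expRB /free_energy lnK // mulrC.
Qed.

Lemma mxpow_gibbs_udiag n (b : R) (P : 'M[C]_n) h (a : R) : (0 < n)%N -> unitarymatrix P ->
  mxpow (gibbs b (udiag P (fun i => (h i)%:C))) a%:C =
  udiag P (fun i => (expR (a * (- (b * h i) - free_energy b h)))%:C).
Proof.
move=> n0 hP; rewrite gibbs_udiag // /mxpow mxfun_udiag //; apply: eq_udiag => i.
by rewrite /cpow /= expRK -rmorphM cexp_real.
Qed.

Lemma posdef_mxpow_gibbs n (b : R) (H : 'M[C]_n) (a : R) : (0 < n)%N -> selfadjoint H ->
  posdef (mxpow (gibbs b H) a%:C).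
Proof.
move=> n0 /selfadjoint_udiag[P [h [hP ->]]]; rewrite mxpow_gibbs_udiag //.
by apply: posdef_udiag => // i; rewrite ltcR expR_gt0.
Qed.

Lemma posdef_gibbs n (b : R) (H : 'M[C]_n) : (0 < n)%N -> selfadjoint H ->
  posdef (gibbs b H).
Proof.
move=> n0 /selfadjoint_udiag[P [h [hP ->]]]; rewrite gibbs_udiag //.
by apply: posdef_udiag => // i; rewrite ltcR expR_gt0.
Qed.

Lemma mxtrace_gibbs n (b : R) (H : 'M[C]_n) : (0 < n)%N -> selfadjoint H ->
  \tr (gibbs b H) = 1.
Proof.
move=> n0 sH; have p1 := posdef_gibbs b n0 sH; have := p1.
(* Were the partition function zero, its inverse would be 0 by convention and the Gibbs matrix would
   vanish, contradicting positive definiteness. *)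
rewrite /gibbs mxtraceZ => _; apply: mulVf; apply: contraTneq isT => h.
have := posdef_neq0 n0 p1; rewrite /gibbs h invr0 scale0r eqxx //.
Qed.

Lemma Psi_suml d1 d2 (U : 'M[C]_(d1 * d2)) I (r : seq I) A B X :
  Psi U (\sum_(i <- r) A i) B X = \sum_(i <- r) Psi U (A i) B X.
Proof.
elim: r => [|i r IHr]; last by rewrite !big_cons PsiDl IHr.
by rewrite !big_nil -[X in Psi _ X _ _](scale0r 0) PsiZl scale0r.
Qed.

Lemma Psi_sumr d1 d2 (U : 'M[C]_(d1 * d2)) I (r : seq I) A B X :
  Psi U A (\sum_(i <- r) B i) X = \sum_(i <- r) Psi U A (B i) X.
Proof.
elim: r => [|i r IHr]; last by rewrite !big_cons PsiDr IHr.
by rewrite !big_nil -[X in Psi _ _ X _](scale0r 0) PsiZr scale0r.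
Qed.

Lemma ptr_sandwich d1 d2 (U : 'M[C]_(d1 * d2)) (A B rho : 'M[C]_d2) (X : 'M[C]_d1) :
  let K := (1%:M *t A) *m (U *m (1%:M *t B)) in
  ptr (K *m (X *t rho) *m mxadj K) = Psi U (mxadj A *m A) (B *m rho *m mxadj B) X.
Proof.
rewrite /= /Psi !mxadjM !mxadj_tens !mxadj1 !mulmxA.
rewrite -ptr_cyclic !mulmxA tensmx_mul mulmx1; congr ptr.
rewrite -!mulmxA; congr (_ *m (_ *m _)); rewrite !mulmxA; congr (_ *m _).
by rewrite !tensmx_mul mul1mx mulmx1.
Qed.

(** [A] and [B] stand for the projections of the second and first measurement, and [rho] for a probe
    state commuting with [B]. Splitting the weight as [a * b] attaches one factor to each
    projection. *)
Lemma ptr_sandwich_projector d1 d2 (U : 'M[C]_(d1 * d2)) (A B rho : 'M[C]_d2)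
    (X : 'M[C]_d1) (a b : C) :
  mxadj A *m A = A -> B *m rho *m mxadj B = B *m rho ->
  (a * b) *: (let K := (1%:M *t A) *m (U *m (1%:M *t B)) in
    ptr (K *m (X *t rho) *m mxadj K)) = Psi U (a *: A) (b *: B *m rho) X.
Proof.
move=> hA hB; rewrite [X in _ *: X]ptr_sandwich hA hB -scalemxAl PsiZl PsiZr.
by rewrite scalerA.
Qed.

End Gibbs.

Section Model.
Variable R : realType.
Local Notation C := R[i].
Variables (dS M : nat) (dE : 'I_M -> nat).
Variables (HS : 'M[C]_dS) (HE : forall j : 'I_M, 'M[C]_(dE j))
          (V : forall j : 'I_M, 'M[C]_(dS * dE j)).
Variables (tau : 'I_M -> R) (betaref : R).
Hypotheses (hdE : forall j, (0 < dE j)%N) (hHE : forall j, selfadjoint (HE j)).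

Local Notation U := (Uj HS HE V tau).
Local Notation rhoE := (rhoE HE betaref).

(* The predual of the deformed map [Ldj] for the trace pairing. *)
Definition Pj (zeta alpha : 'I_M -> R) (k : 'I_M) : 'M[C]_dS -> 'M[C]_dS :=
  Psi (U k) (mxpow (rhoE zeta k) (alpha k)%:C) (mxpow (rhoE zeta k) (1 - alpha k)%:C).

(** With S the measured observable and F the log partition function, the Gibbs state is exp(- S -
    F). The weighted projections sum to exp(- alpha S) and exp(alpha S) times the state; these are
    its powers alpha and 1 - alpha up to the reciprocal factors exp(alpha F) and exp(- alpha F). *)
Lemma sum_pairs_Pj zeta alpha k X :
  \sum_(p <- pairs HE betaref zeta k)
    cexp (- ((alpha k)%:C * (p.2 - p.1))) *:
    (let K := (1%:M *t specproj (Sop HE betaref zeta k) p.2) *m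
             (U k *m (1%:M *t specproj (Sop HE betaref zeta k) p.1)) in
    ptr (K *m (X *t rhoE zeta k) *m mxadj K)) = Pj zeta alpha k X.
Proof.
rewrite /Pj /rhoE /Sop; set b := betaj betaref zeta k; set a := alpha k.
have [P [h [hP HkE]]] := selfadjoint_udiag (hHE k).
rewrite !HkE !mxpow_gibbs_udiag // gibbs_udiag //.
rewrite /pairs /Sop -/b HkE udiagZ big_allpairs_dep /=.
set s : 'I_(dE k) -> C := fun i => b%:C * (h i)%:C.
set w : 'I_(dE k) -> C := fun i => (expR (- (b * h i) - free_energy b h))%:C.
set S := udiag P s.
have term x y : cexp (- (a%:C * (y - x))) *:
    ptr ((1%:M *t specproj S y) *m (U k *m (1%:M *t specproj S x)) *m (X *t udiag P w) *m
      mxadj ((1%:M *t specproj S y) *m (U k *m (1%:M *t specproj S x)))) =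
    Psi (U k) (cexp (- a%:C * y) *: specproj S y) (cexp (a%:C * x) *: specproj S x *m udiag P w) X.
  have -> : cexp (- (a%:C * (y - x))) = cexp (- a%:C * y) * cexp (a%:C * x).
    by rewrite -cexpD; congr cexp; ring.
  apply: ptr_sandwich_projector; rewrite (specproj_udiag _ _ hP) udiag_adj.
    rewrite (udiagM _ _ hP); apply: eq_udiag => i.
    by rewrite rmorph_nat -natrM mulnb andbb.
  rewrite !(udiagM _ _ hP); apply: eq_udiag => i.
  by rewrite rmorph_nat mulrAC -natrM mulnb andbb.
under eq_bigr => x _ do under eq_bigr => y _ do rewrite term.
under eq_bigr => x _ do rewrite -Psi_suml.
rewrite -Psi_sumr -mulmx_suml.
have := mxfun_udiag s (fun y => cexp (- a%:C * y)) hP; rewrite /mxfun -/S => ->.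
have := mxfun_udiag s (fun x => cexp (a%:C * x)) hP; rewrite /mxfun -/S => ->.
rewrite (udiagM _ _ hP) {term}.
set F := free_energy b h in w *.
have -> : udiag P (fun i => cexp (- a%:C * s i)) =
    (expR (a * F))%:C *: udiag P (fun i => (expR (a * (- (b * h i) - F)))%:C).
  rewrite udiagZ; apply: eq_udiag => i.
  rewrite /s mulNr -!rmorphM -rmorphN cexp_real -expRD; congr (expR _)%:C; ring.
have -> : udiag P (fun i => cexp (a%:C * s i) * w i) =
    (expR (- (a * F)))%:C *: udiag P (fun i => (expR ((1 - a) * (- (b * h i) - F)))%:C).
  rewrite udiagZ; apply: eq_udiag => i.
  rewrite /s /w -!rmorphM cexp_real -rmorphM -!expRD; congr (expR _)%:C; ring.
by rewrite PsiZl PsiZr scalerA -rmorphM -expRD subrr expR0 scale1r.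
Qed.

Lemma foldl_map_fun (A B X : Type) (f : A -> B) (G : X -> B -> X) (x : X) (r : seq A) :
  foldl G x (map f r) = foldl (fun y i => G y (f i)) x r.
Proof. by elim: r x => //= i r IHr x. Qed.

Lemma linear_foldl (I : Type) (F : I -> 'M[C]_dS -> 'M[C]_dS) (w : I -> C) (r : seq I) X :
  (forall i, linear (F i)) ->
  foldl (fun Y i => w i *: F i Y) X r = (\prod_(i <- r) w i) *: foldl (fun Y i => F i Y) X r.
Proof.
move=> linF; have linZ i c Y : F i (c *: Y) = c *: F i Y := linmapZ c Y (linF i).
suff h c Y : foldl (fun Y i => w i *: F i Y) (c *: Y) r =
    (c * \prod_(i <- r) w i) *: foldl (fun Y i => F i Y) Y r.
  by rewrite -{1}[X]scale1r h mul1r.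
elim: r c Y => [|i r IHr] c Y /=; first by rewrite big_nil mulr1.
by rewrite linZ scalerA IHr big_cons [w i * c]mulrC mulrA.
Qed.

Section Path.
Variables (N : nat) (j : 'I_N -> 'I_M) (zeta : 'I_M -> R).

Let K (n : 'I_N) (p : C * C) : 'M[C]_(dS * dE (j n)) :=
  (1%:M *t specproj (Sop HE betaref zeta (j n)) p.2) *m
  (U (j n) *m (1%:M *t specproj (Sop HE betaref zeta (j n)) p.1)).

Lemma prob_collide rho (s : seq (C * C)) :
  prob HS HE V tau betaref zeta j rho s =
  \tr (foldl (fun X n => collide (fun n => K n (nth (0, 0) s n))
                 (fun n => rhoE zeta (j n)) n X) rho (enum 'I_N)).
Proof.
rewrite -otr_collisions // /prob /rhotot; congr (otr (omul (omul _ _) (oadj _))).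
all: rewrite /Ucal -big_omul_seq /index_enum enumT; apply: eq_bigr => n _;
  by rewrite /step !liftE_SE !omul_liftSE.
Qed.

Lemma mgf_foldl rho alpha :
  mgf HS HE V tau betaref zeta j rho (cvec alpha) =
  \tr (foldl (fun X n => Pj zeta alpha (j n) X) rho (enum 'I_N)).
Proof.
pose E (n : 'I_N) (p : C * C) (X : 'M[C]_dS) : 'M[C]_dS :=
  cexp (- ((alpha (j n))%:C * (p.2 - p.1))) *:
  ptr (K n p *m (X *t rhoE zeta (j n)) *m mxadj (K n p)).
have linE n p : linear (E n p).
  move=> c X Y; rewrite /E tensmxDl tensmxZl mulmxDr mulmxDl ptrD scalerDr.
  by rewrite -scalemxAr -scalemxAl ptrZ !scalerA mulrC.
transitivity (\tr (\sum_(s <- outcomes HE betaref zeta j)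
    foldl (fun u q => E q.1 q.2 u) rho (zip (enum 'I_N) s))).
  rewrite raddf_sum; apply: eq_big_seq => s /size_cprod; rewrite size_map size_enum_ord => hs.
  rewrite prob_collide.
  (* An outcome list has exactly [N] entries, so the default (0, 0) is never read. *)
  have -> : zip (enum 'I_N) s = [seq (n, nth (0, 0) s (val n)) | n : 'I_N <- enum 'I_N].
    rewrite -{1}(mkseq_nth (0, 0) s) /mkseq hs -val_enum_ord -map_comp.
    by rewrite -[X in zip X _](map_id (enum 'I_N)) zip_map.
  rewrite [RHS]/= /E linear_foldl; last first.
    move=> n c X Y; rewrite tensmxDl tensmxZl mulmxDr mulmxDl ptrD.
    by rewrite -scalemxAr -scalemxAl ptrZ.
  rewrite [RHS]mxtraceZ mulrC cexpN_sum big_map foldl_map_fun big_enum /=.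
  by congr (_ * _); rewrite ?enumT.
congr (\tr _); rewrite /outcomes sum_cprod //.
have aux (r : seq 'I_N) Y :
    foldl (fun u n => \sum_(x <- pairs HE betaref zeta (j n)) E n x u) Y r =
    foldl (fun X n => Pj zeta alpha (j n) X) Y r.
  by elim: r Y => //= n r IHr Y; rewrite IHr /E sum_pairs_Pj.
exact: aux.
Qed.

End Path.
End Model.

(** * Spectral radii under duality, similarity and time reversal *)

Section Spectrum.
Variable R : realType.
Variable n : nat.
Local Notation C := R[i].
Implicit Types L : 'M[C]_n -> 'M[C]_n.

Lemma linear_injective_surjective L : linear L ->
  (forall X, L X = 0 -> X = 0) -> forall Y, exists X, L X = Y.
Proof.
move=> lL inj Y.
pose f : {linear 'M[C]_n -> 'M[C]_n} := HB.pack L (GRing.isLinear.Build _ _ _ _ L lL).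
have fE X : mxvec X *m lin_mx f = mxvec (L X) by rewrite mul_vec_lin.
have U : lin_mx f \in unitmx.
  rewrite -row_free_unit -kermx_eq0; apply/rowV0P => v /sub_kermxP hv.
  have : L (vec_mx v) = 0.
    by apply: (can_inj mxvecK); rewrite -fE vec_mxK hv linear0.
  by move/inj => h; rewrite -[v]vec_mxK h linear0.
exists (vec_mx (mxvec Y *m invmx (lin_mx f))).
by apply: (can_inj mxvecK); rewrite -fE vec_mxK mulmxKV.
Qed.

(** Only moduli are matched, because an antilinear conjugation turns an eigenvalue into its
    conjugate. *)
Lemma eq_specrad L L' :
  (forall z X, X != 0 -> L X = z *: X ->
     exists z' X', [/\ X' != 0, L' X' = z' *: X' & Normc.normc z' = Normc.normc z]) ->
  (forall z X, X != 0 -> L' X = z *: X ->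
     exists z' X', [/\ X' != 0, L X' = z' *: X' & Normc.normc z' = Normc.normc z]) ->
  specrad L = specrad L'.
Proof.
move=> h1 h2; congr sup; apply/seteqP; split=> _ [z [X [X0 LX]] <-].
  by have [z' [X' [X'0 LX' <-]]] := h1 z X X0 LX; exists z' => //; exists X'.
by have [z' [X' [X'0 LX' <-]]] := h2 z X X0 LX; exists z' => //; exists X'.
Qed.

(** Otherwise L' - z is injective, hence surjective, and reaches [mxadj X]. Pairing with X and using
    duality gives Tr([mxadj X *m X]) = 0, impossible for X nonzero. *)
Lemma tdual_eigenvalue L L' z : linear L' -> tdual L L' ->
  (exists X, X != 0 /\ L X = z *: X) -> exists X, X != 0 /\ L' X = z *: X.
Proof.
move=> lL' dL [X [X0 LX]]; apply: contrapT => none.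
have linD : linear (fun Y => L' Y - z *: Y).
  move=> c A B; rewrite lL' scalerDr opprD addrACA scalerBr !scalerA.
  by rewrite [z * c]mulrC.
have inj Y : L' Y - z *: Y = 0 -> Y = 0.
  move=> h; apply: contrapT => /eqP Y0; apply: none; exists Y; split=> //.
  by apply/eqP; rewrite -subr_eq0 h.
move/eqP: X0; apply; have [Y hY] := linear_injective_surjective linD inj (mxadj X).
have h0 : \tr (mxadj X *m X) = 0.
  by rewrite -hY mulmxBl mxtraceB -dL LX -scalemxAl -scalemxAr !mxtraceZ subrr.
apply: contrapT => /eqP X0.
have : 0 < \tr (mxadj X *m X).
  apply: psd_trace_gt0; first exact: psd_gram.
  apply: contraNneq X0 => XX; apply/eqP/matrixP => a b.
  pose v : 'cV[C]_n := delta_mx b 0.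
  have : (mxadj (X *m v) *m (X *m v)) 0 0 = 0.
    by rewrite mxadjM mulmxA -(mulmxA _ (mxadj X)) XX mulmx0 mul0mx mxE.
  by move/sqnorm_eq0; rewrite /v -colE => /colP/(_ a); rewrite !mxE.
by rewrite h0 ltxx.
Qed.

Lemma specrad_tdual L L' : linear L -> linear L' -> tdual L L' -> specrad L = specrad L'.
Proof.
move=> lL lL' dL; apply: eq_specrad => z X X0 LX.
  have [Y [Y0 LY]] := tdual_eigenvalue lL' dL (ex_intro _ X (conj X0 LX)).
  by exists z, Y.
have [Y [Y0 LY]] := tdual_eigenvalue lL (tdual_sym dL) (ex_intro _ X (conj X0 LX)).
by exists z, Y.
Qed.

Lemma specrad_similar L L' (rho : 'M[C]_n) : rho \in unitmx ->
  (forall X, L' (X *m rho) = L X *m rho) -> specrad L = specrad L'.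
Proof.
move=> urho h; apply: eq_specrad => z X X0 LX.
  exists z, (X *m rho); split=> //; last by rewrite h LX scalemxAl.
  by apply: contraNneq X0 => e; rewrite -[X](mulmxK urho) e mul0mx.
exists z, (X *m invmx rho); split=> //.
  by apply: contraNneq X0 => e; rewrite -[X](mulmxKV urho) e mul0mx.
apply: (can_inj (mulmxK urho)); rewrite -h mulmxKV // LX -scalemxAl.
by rewrite mulmxKV.
Qed.

(* The conjugation X |-> theta X theta^-1 by the antiunitary theta = W o K. *)
Definition anticonj (W X : 'M[C]_n) : 'M[C]_n := W *m map_mx conjc X *m mxadj W.

Lemma map_conjcK m p (A : 'M[C]_(m, p)) : map_mx conjc (map_mx conjc A) = A.
Proof. by apply/matrixP => i j; rewrite !mxE conjcK. Qed.

Lemma anticonjZ W c X : anticonj W (c *: X) = conjc c *: anticonj W X.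
Proof. by rewrite /anticonj map_mxZ -scalemxAr -scalemxAl. Qed.

Lemma anticonj0 W : anticonj W 0 = 0.
Proof. by rewrite /anticonj raddf0 mulmx0 mul0mx. Qed.

Lemma anticonjK W X : W *m map_mx conjc W = 1%:M -> anticonj W (anticonj W X) = X.
Proof.
move=> WW; rewrite /anticonj !map_mxM map_conjcK !mulmxA WW mul1mx -mulmxA.
have -> : map_mx conjc (mxadj W) *m mxadj W = mxadj (W *m map_mx conjc W).
  rewrite mxadjM; congr (_ *m _); apply/matrixP => i j.
  by rewrite !mxE.
by rewrite WW mxadj1 mulmx1.
Qed.

Lemma normc_conjc (z : C) : Normc.normc (conjc z) = Normc.normc z.
Proof. by case: z => a b /=; rewrite sqrrN. Qed.

Lemma specrad_anticonj L L' W : W *m map_mx conjc W = 1%:M ->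
  (forall X, anticonj W (L X) = L' (anticonj W X)) -> specrad L = specrad L'.
Proof.
move=> WW h.
have inj X : X != 0 -> anticonj W X != 0.
  by apply: contraNneq => e; rewrite -[X](anticonjK _ WW) e anticonj0.
apply: eq_specrad => z X X0 LX; exists (conjc z), (anticonj W X).
  by split; [exact: inj | rewrite -h LX anticonjZ | exact: normc_conjc].
split; [exact: inj | | exact: normc_conjc].
by rewrite -anticonjZ -LX -{2}[X](anticonjK _ WW) -h anticonjK.
Qed.

End Spectrum.

(** * Antiunitary conjugation of partial traces and of functions of a Hamiltonian *)

Section TimeReversal.
Variable R : realType.
Local Notation C := R[i].

Lemma anticonjM n (W X Y : 'M[C]_n) : unitarymatrix W ->
  anticonj W (X *m Y) = anticonj W X *m anticonj W Y.
Proof.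
move=> hW; rewrite /anticonj map_mxM !mulmxA -(mulmxA _ (mxadj W) W).
by rewrite (unitarymatrixV hW) mulmx1.
Qed.

Lemma anticonjD n (W X Y : 'M[C]_n) : anticonj W (X + Y) = anticonj W X + anticonj W Y.
Proof. by rewrite /anticonj map_mxD mulmxDr mulmxDl. Qed.

Lemma anticonj1 n (W : 'M[C]_n) : unitarymatrix W -> anticonj W 1%:M = 1%:M.
Proof. by move=> hW; rewrite /anticonj map_mx1 mulmx1 hW. Qed.

Lemma anticonj_adj n (W X : 'M[C]_n) : anticonj W (mxadj X) = mxadj (anticonj W X).
Proof.
rewrite /anticonj !mxadjM mxadjK mulmxA; congr (_ *m _ *m _).
by apply/matrixP => i j; rewrite !mxE.
Qed.

Lemma anticonj_tens m n (W : 'M[C]_m) (W' : 'M[C]_n) X Y :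
  anticonj (W *t W') (X *t Y) = anticonj W X *t anticonj W' Y.
Proof. by rewrite /anticonj map_mxT mxadj_tens !tensmx_mul. Qed.

Lemma unitarymatrix_tens m n (W : 'M[C]_m) (W' : 'M[C]_n) :
  unitarymatrix W -> unitarymatrix W' -> unitarymatrix (W *t W').
Proof.
by move=> h h'; rewrite /unitarymatrix mxadj_tens tensmx_mul h h' tensmx11.
Qed.

Lemma eq_mulcV m n (A B : 'M[C]_(m, n)) : (forall v : 'cV[C]_n, A *m v = B *m v) -> A = B.
Proof.
move=> h; apply/matrixP => i k; have /matrixP/(_ i 0) := h (delta_mx k 0).
by rewrite -!colE !mxE.
Qed.

Lemma anticommutes_anticonj n (W A : 'M[C]_n) : unitarymatrix W ->
  anticommutes W A -> anticonj W A = A.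
Proof.
move=> hW h; have e : W *m map_mx conjc A = A *m W.
  apply: eq_mulcV => v; have := h (map_mx conjc v).
  by rewrite /antiop map_mxM map_conjcK !mulmxA.
by rewrite /anticonj e -mulmxA hW mulmx1.
Qed.

Lemma antiunitary_involution_mul n (W : 'M[C]_n) : antiunitary_involution W ->
  W *m map_mx conjc W = 1%:M.
Proof.
move=> [_ h]; apply: eq_mulcV => v; rewrite mul1mx -{2}[v]h /antiop.
by rewrite map_mxM map_conjcK mulmxA.
Qed.

Lemma anticonj_udiag n (W P : 'M[C]_n) d :
  anticonj W (udiag P d) = udiag (map_mx conjc P *m mxadj W) (fun i => conjc (d i)).
Proof.
have e1 : map_mx conjc (mxadj P) = mxadj (map_mx conjc P).
  by apply/matrixP => i j; rewrite !mxE.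
have e2 : map_mx conjc (diag_mx (\row_i d i)) = diag_mx (\row_i conjc (d i)).
  by apply/matrixP => i j; rewrite !mxE rmorphMn.
by rewrite /anticonj /udiag !map_mxM e1 e2 mxadjM mxadjK !mulmxA.
Qed.

Lemma unitarymatrix_conj n (P : 'M[C]_n) : unitarymatrix P -> unitarymatrix (map_mx conjc P).
Proof.
move=> hP; rewrite /unitarymatrix.
have -> : mxadj (map_mx conjc P) = map_mx conjc (mxadj P) by apply/matrixP => i j; rewrite !mxE.
by rewrite -map_mxM hP map_mx1.
Qed.

(** [W] leaves the partial trace on both sides, while [W'] meets its adjoint by partial cyclicity
    and disappears. *)
Lemma ptr_anticonj d1 d2 (W : 'M[C]_d1) (W' : 'M[C]_d2) (A : 'M[C]_(d1 * d2)) :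
  unitarymatrix W' -> anticonj W (ptr A) = ptr (anticonj (W *t W') A).
Proof.
move=> hW'; rewrite /anticonj mxadj_tens.
have -> : W *t W' = (W *t 1%:M) *m (1%:M *t W') by rewrite tensmx_mul mul1mx mulmx1.
have -> : mxadj W *t mxadj W' = (1%:M *t mxadj W') *m (mxadj W *t 1%:M).
  by rewrite tensmx_mul mul1mx mulmx1.
rewrite !mulmxA ptr_mulr -!mulmxA ptr_mull ptr_cyclic -!mulmxA tensmx_mul mulmx1.
rewrite (unitarymatrixV hW') tensmx11 mulmx1 !mulmxA; congr (_ *m _ *m _).
by apply/matrixP => i j; rewrite !mxE rmorph_sum; apply: eq_bigr => b _; rewrite mxE.
Qed.

Lemma Psi_anticonj d1 d2 (W : 'M[C]_d1) (W' : 'M[C]_d2) (U : 'M[C]_(d1 * d2)) A B X :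
  unitarymatrix W -> unitarymatrix W' ->
  anticonj W (Psi U A B X) =
  Psi (anticonj (W *t W') U) (anticonj W' A) (anticonj W' B) (anticonj W X).
Proof.
move=> hW hW'; have hWW := unitarymatrix_tens hW hW'.
rewrite /Psi (ptr_anticonj _ _ hW') !(anticonjM _ _ hWW) !anticonj_tens.
by rewrite (anticonj1 hW) anticonj_adj.
Qed.

Lemma mxpow_gibbs_anticonj n (W H : 'M[C]_n) (b a : R) : (0 < n)%N ->
  unitarymatrix W -> selfadjoint H -> anticonj W H = H ->
  anticonj W (mxpow (gibbs b H) a%:C) = mxpow (gibbs b H) a%:C.
Proof.
move=> n0 hW /selfadjoint_udiag[P [h [hP HE]]] hH.
have hP' : unitarymatrix (map_mx conjc P *m mxadj W).
  by apply: unitarymatrixM; [exact: unitarymatrix_conj | exact: unitarymatrix_adj].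
have HE' : H = udiag (map_mx conjc P *m mxadj W) (fun i => (h i)%:C).
  by rewrite -hH HE anticonj_udiag; apply: eq_udiag => i; exact: conjc_real.
rewrite {1}HE (mxpow_gibbs_udiag _ _ _ n0 hP) anticonj_udiag HE' (mxpow_gibbs_udiag _ _ _ n0 hP').
by apply: eq_udiag => i; exact: conjc_real.
Qed.

(** Invariance gives [H] a second diagonalisation with the same real eigenvalues; antilinearity
    conjugates the values of [f] there, which is the adjoint. For f(x) = exp(- i tau x) this is the
    reversal of the propagator. *)
Lemma mxfun_anticonj n (W H : 'M[C]_n) (f : C -> C) :
  unitarymatrix W -> selfadjoint H -> anticonj W H = H ->
  anticonj W (mxfun f H) = mxadj (mxfun f H).
Proof.
move=> hW /selfadjoint_udiag[P [h [hP HE]]] hH.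
have hP' : unitarymatrix (map_mx conjc P *m mxadj W).
  by apply: unitarymatrixM; [exact: unitarymatrix_conj | exact: unitarymatrix_adj].
have HE' : H = udiag (map_mx conjc P *m mxadj W) (fun i => (h i)%:C).
  by rewrite -hH HE anticonj_udiag; apply: eq_udiag => i; exact: conjc_real.
rewrite {1}HE mxfun_udiag // anticonj_udiag HE' mxfun_udiag // udiag_adj.
by [].
Qed.

End TimeReversal.

(** * The deformed maps of the model *)

Section MainSteps.
Variable R : realType.
Local Notation C := R[i].
Variables (dS M : nat) (dE : 'I_M -> nat).
Variables (HS : 'M[C]_dS) (HE : forall j : 'I_M, 'M[C]_(dE j))
          (V : forall j : 'I_M, 'M[C]_(dS * dE j)).
Variables (tau : 'I_M -> R) (betaref : R).
Hypotheses (hdS : (0 < dS)%N) (hdE : forall j, (0 < dE j)%N).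
Hypotheses (hHS : selfadjoint HS) (hHE : forall j, selfadjoint (HE j)).
Hypothesis hV : forall j, selfadjoint (V j).

Local Notation U := (Uj HS HE V tau).
Local Notation rhoE := (rhoE HE betaref).
Local Notation Pj := (Pj HS HE V tau betaref).
Local Notation Ldj := (Ldj HS HE V tau betaref).
Local Notation Lj := (Lj HS HE V tau betaref).

Definition Psharp (sh : sharp) (zeta alpha : 'I_M -> R) (X : 'M[C]_dS) : 'M[C]_dS :=
  match sh with
  | Cy => foldl (fun Y k => Pj zeta alpha k Y) X (enum 'I_M)
  | Ra => (M%:R)^-1 *: \sum_(k < M) Pj zeta alpha k X
  end.

Definition Ldsharp (sh : sharp) zeta (a : 'I_M -> C) : 'M[C]_dS -> 'M[C]_dS :=
  match sh with
  | Cy => Ldcy HS HE V tau betaref zeta a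
  | Ra => Ldra HS HE V tau betaref zeta a
  end.

Lemma rsharpE sh zeta a :
  rsharp HS HE V tau betaref sh zeta a = specrad (Ldsharp sh zeta a).
Proof. by case: sh. Qed.

Lemma Ldj_Psi zeta alpha k :
  Ldj zeta (cvec alpha) k = Psi (mxadj (U k)) (mxpow (rhoE zeta k) (1 - alpha k)%:C)
    (mxpow (rhoE zeta k) (alpha k)%:C).
Proof. by apply/funext => X; rewrite /Ldj /Psi mxadjK /cvec rmorphB. Qed.

Lemma Lj_Psi zeta k : Lj zeta k = Psi (U k) 1%:M (rhoE zeta k).
Proof. by apply/funext => X; rewrite /Lj /Psi tensmx11 mul1mx. Qed.

Lemma Psi_posmap d1 d2 (W : 'M[C]_(d1 * d2)) A B : psd A -> psd B -> posmap (Psi W A B).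
Proof. by move=> pA pB; split; [exact: Psi_linear | move=> X pX; exact: Psi_pos]. Qed.

Lemma PsiBZl d1 d2 (W : 'M[C]_(d1 * d2)) A A' B c X :
  Psi W (A - c *: A') B X = Psi W A B X - c *: Psi W A' B X.
Proof. by rewrite -scaleNr PsiDl PsiZl scaleNr. Qed.

Lemma PsiBZr d1 d2 (W : 'M[C]_(d1 * d2)) A B B' c X :
  Psi W A (B - c *: B') X = Psi W A B X - c *: Psi W A B' X.
Proof. by rewrite -scaleNr PsiDr PsiZr scaleNr. Qed.

(** Replace [A] by a multiple of [A'] and then [B] by a multiple of [B']; each replacement leaves a
    [Psi] with positive semidefinite parameters. *)
Lemma Psi_dominates d1 d2 (W : 'M[C]_(d1 * d2)) A B A' B' :
  posdef A -> posdef B -> psd A' -> psd B' -> dominates (Psi W A B) (Psi W A' B').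
Proof.
move=> pA pB pA' pB'.
have [a a0 ha] := posdef_dominates pA (proj1 pA').
have [b b0 hb] := posdef_dominates pB (proj1 pB').
exists (a * b) => [|X pX]; first exact: mulr_gt0.
have -> : Psi W A B X - (a * b)%:C *: Psi W A' B' X =
    Psi W (A - a%:C *: A') B X + a%:C *: Psi W A' (B - b%:C *: B') X.
  by rewrite PsiBZl PsiBZr scalerBr scalerA -rmorphM addrA subrK.
apply: psdD; first exact: Psi_pos ha (posdef_psd pB) pX.
by apply: psdZ; [rewrite ler0c ltW | exact: Psi_pos].
Qed.

Let pw zeta k a : posdef (mxpow (rhoE zeta k) a%:C) := posdef_mxpow_gibbs _ a (hdE k) (hHE k).

Lemma posmap_Pj zeta alpha k : posmap (Pj zeta alpha k).
Proof. by apply: Psi_posmap; exact: posdef_psd. Qed.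

Lemma posmap_Ldj zeta alpha k : posmap (Ldj zeta (cvec alpha) k).
Proof. by rewrite Ldj_Psi; apply: Psi_posmap; exact: posdef_psd. Qed.

Let posdef_rhoE zeta k : posdef (rhoE zeta k) := posdef_gibbs _ (hdE k) (hHE k).

Lemma posmap_Lj zeta k : posmap (Lj zeta k).
Proof. by rewrite Lj_Psi; apply: Psi_posmap; [exact: psd1 | exact: posdef_psd]. Qed.

Lemma Minv_ge0 : 0 <= (M%:R : C)^-1.
Proof. by rewrite invr_ge0 ler0n. Qed.

Lemma posmap_Psharp sh zeta alpha : posmap (Psharp sh zeta alpha).
Proof.
case: sh; first exact: (posmap_foldl (enum 'I_M) (posmap_Pj zeta alpha)).
exact: (posmapZ Minv_ge0 (posmap_sum (index_enum 'I_M) (posmap_Pj zeta alpha))).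
Qed.

Lemma posmap_Ldsharp sh zeta alpha : posmap (Ldsharp sh zeta (cvec alpha)).
Proof.
case: sh; first exact: (posmap_foldr (enum 'I_M) (posmap_Ldj zeta alpha)).
exact: (posmapZ Minv_ge0 (posmap_sum (index_enum 'I_M) (posmap_Ldj zeta alpha))).
Qed.

Lemma posmap_Lsharp sh zeta : posmap (Lsharp HS HE V tau betaref sh zeta).
Proof.
case: sh; first exact: (posmap_foldl (enum 'I_M) (posmap_Lj zeta)).
exact: (posmapZ Minv_ge0 (posmap_sum (index_enum 'I_M) (posmap_Lj zeta))).
Qed.

Lemma tdual_Psharp sh zeta alpha :
  tdual (Psharp sh zeta alpha) (Ldsharp sh zeta (cvec alpha)).
Proof.
have h k : tdual (Pj zeta alpha k) (Ldj zeta (cvec alpha) k).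
  by rewrite Ldj_Psi; apply: Psi_dual.
case: sh; first exact: (tdual_fold (enum 'I_M) h).
exact: (tdualZ (M%:R)^-1 (tdual_sum (index_enum 'I_M) h)).
Qed.

(** The undeformed map at [zeta'] has parameters 1 and the Gibbs state, so primitivity at one
    [zeta'] reaches all [zeta] and [alpha]. *)
Lemma Psharp_dominates sh zeta zeta' alpha :
  dominates (Psharp sh zeta alpha) (Lsharp HS HE V tau betaref sh zeta').
Proof.
have h k : dominates (Pj zeta alpha k) (Lj zeta' k).
  by rewrite Lj_Psi; apply: Psi_dominates => //; [exact: psd1 | exact: posdef_psd].
case: sh; first exact: (dominates_foldl _ (posmap_Pj zeta alpha) (posmap_Lj zeta') h).
exact: (dominatesZ Minv_ge0 (dominates_sum (index_enum 'I_M) (posmap_Lj zeta') h)).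
Qed.

(** Moves primitivity between temperatures for the undeformed maps, whose fixed point under (NE) has
    to be shown invertible. *)
Lemma Lsharp_dominates sh zeta zeta' :
  dominates (Lsharp HS HE V tau betaref sh zeta) (Lsharp HS HE V tau betaref sh zeta').
Proof.
have h k : dominates (Lj zeta k) (Lj zeta' k).
  rewrite !Lj_Psi; apply: Psi_dominates => //; [exact: posdef1 | exact: psd1 | exact: posdef_psd].
case: sh; first exact: (dominates_foldl _ (posmap_Lj zeta) (posmap_Lj zeta') h).
exact: (dominatesZ Minv_ge0 (dominates_sum (index_enum 'I_M) (posmap_Lj zeta') h)).
Qed.

Lemma ER_improving_L sh zeta : ER HS HE V tau betaref sh ->
  improving (Lsharp HS HE V tau betaref sh zeta).
Proof.
move=> [zeta' /primitive_improving]; apply: improving_dominates.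
- exact: posmap_Lsharp.
- exact: posmap_Lsharp.
- exact: Lsharp_dominates.
Qed.

Lemma ER_improving sh zeta alpha : ER HS HE V tau betaref sh ->
  improving (Ldsharp sh zeta (cvec alpha)).
Proof.
move=> [zeta' /primitive_improving h].
apply: improving_tdual (posmap_Ldsharp _ _ _) (tdual_Psharp _ _ _) _.
exact: improving_dominates (posmap_Psharp _ _ _) (posmap_Lsharp _ _) (Psharp_dominates _ _ _ _) h.
Qed.

(** * Moment generating functions as traces of iterates *)

Section MGF.
Variables (zeta alpha : 'I_M -> R).

Lemma foldl_periodic (T : Type) (G : nat -> T -> T) (x : T) (N : nat) :
  (forall m, G (M + m)%N = G m) ->
  foldl (fun y m => G m y) x (iota 0 (N * M)) =
  iter N (fun y => foldl (fun y m => G m y) y (iota 0 M)) x.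
Proof.
move=> hG; elim: N x => [|N IHN] x //.
have shift : iota M (N * M) = map (addn M) (iota 0 (N * M)) by rewrite -iotaDl addn0.
rewrite mulSn iotaD foldl_cat add0n shift foldl_map_fun iterSr -IHN.
elim: (iota 0 (N * M)) (foldl _ x _) => //= m r IHr y.
by rewrite hG IHr.
Qed.

Lemma mgf_cyE (hM : (0 < M)%N) N rho :
  mgf_cy HS HE V tau betaref hM zeta N rho (cvec alpha) =
  \tr (iter N (Psharp Cy zeta alpha) rho).
Proof.
rewrite /mgf_cy mgf_foldl //; congr (\tr _).
pose G m := Pj zeta alpha (Ordinal (ltn_pmod m hM)).
have -> : foldl (fun X n => Pj zeta alpha (jcy hM n) X) rho (enum 'I_(N * M)) =
    foldl (fun X m => G m X) rho (iota 0 (N * M)).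
  by rewrite -val_enum_ord foldl_map_fun.
rewrite foldl_periodic; last first.
  by move=> m; rewrite /G; congr (Pj _ _ _); apply: val_inj; rewrite /= modnDl.
apply: eq_iter => X; rewrite -val_enum_ord foldl_map_fun /=.
congr (foldl _ X _); apply/funext => Y; apply/funext => k.
by rewrite /G; congr (Pj _ _ _); apply: val_inj; rewrite /= modn_small.
Qed.

Lemma sum_tuple_cons (T : finType) (W : nmodType) N (G : seq T -> W) :
  \sum_(t : N.+1.-tuple T) G t = \sum_(x : T) \sum_(t : N.-tuple T) G (x :: t).
Proof.
rewrite pair_big /= (reindex (fun p : T * N.-tuple T => [tuple of p.1 :: p.2])) //=.
exists (fun t : N.+1.-tuple T => (thead t, [tuple of behead t])) => [[x t] _|t _] /=.
  by congr (_, _); apply: val_inj.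
by rewrite [RHS]tuple_eta; apply: val_inj.
Qed.

(** The noncommutative expansion of a power of a sum over words. *)
Lemma sum_foldl_tuple (F : 'I_M -> 'M[C]_dS -> 'M[C]_dS) N X : (forall k, linear (F k)) ->
  \sum_(t : N.-tuple 'I_M) foldl (fun Y k => F k Y) X t =
  iter N (fun Y => \sum_k F k Y) X.
Proof.
move=> linF; pose S Y := \sum_k F k Y.
have linS : linear S.
  by move=> c A B; rewrite /S scaler_sumr -big_split; apply: eq_bigr => k _; apply: linF.
elim: N X => [|N IHN] X.
  rewrite (eq_bigr (fun=> X)) ?sumr_const ?card_tuple ?expn0 //.
  by move=> t _; rewrite tuple0.
rewrite (sum_tuple_cons _ (fun t => foldl (fun Y k => F k Y) X t)) iterSr.
under eq_bigr => k _ do rewrite IHN.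
have linN : linear (iter N S).
  by elim: (N) => [|m IHm] c A B //=; rewrite IHm linS.
by rewrite [in RHS]/= (linmap_sum _ _ linN).
Qed.

Lemma mgf_raE N rho :
  mgf_ra HS HE V tau betaref zeta N rho (cvec alpha) =
  \tr (iter N (Psharp Ra zeta alpha) rho).
Proof.
have linP k : linear (Pj zeta alpha k) by apply: Psi_linear.
rewrite /mgf_ra; under eq_bigr => w _ do rewrite mgf_foldl //.
rewrite -raddf_sum /= -mxtraceZ; congr (\tr _).
rewrite (reindex (fun t : N.-tuple 'I_M => [ffun n => tnth t n])) /=; last first.
  exists (fun w : {ffun 'I_N -> 'I_M} => [tuple w n | n < N]) => w _.
    by apply: eq_from_tnth => n; rewrite tnth_mktuple ffunE.
  by apply/ffunP => n; rewrite ffunE tnth_mktuple.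
have aux (t : N.-tuple 'I_M) :
    foldl (fun X n => Pj zeta alpha ([ffun n => tnth t n] n) X) rho (enum 'I_N) =
    foldl (fun X k => Pj zeta alpha k X) rho t.
  rewrite -[in RHS](map_tnth_enum t) foldl_map_fun; congr (foldl _ rho _).
  by apply/funext => Y; apply/funext => n; rewrite ffunE.
under eq_bigr => t _ do rewrite aux.
rewrite (sum_foldl_tuple _ _ linP).
pose S Y := \sum_k Pj zeta alpha k Y.
have linS : linear S.
  by move=> c A B; rewrite /S scaler_sumr -big_split; apply: eq_bigr => k _; apply: linP.
elim: N {aux} rho => [|N IHN] rho; first by rewrite expr0 invr1 scale1r.
have -> : iter N.+1 (Psharp Ra zeta alpha) rho =
    (M%:R)^-1 *: S (iter N (Psharp Ra zeta alpha) rho) by [].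
by rewrite -IHN (linmapZ _ _ linS) scalerA exprS invfM.
Qed.

Lemma mgf_sharpE sh (hM : (0 < M)%N) N rho :
  mgf_sharp HS HE V tau betaref sh hM zeta N rho (cvec alpha) =
  \tr (rho *m iter N (Ldsharp sh zeta (cvec alpha)) 1%:M).
Proof.
have -> : mgf_sharp HS HE V tau betaref sh hM zeta N rho (cvec alpha) =
    \tr (iter N (Psharp sh zeta alpha) rho).
  by case: sh; [exact: mgf_cyE | exact: mgf_raE].
rewrite -[iter _ _ rho]mul1mx (tdual_iter N (tdual_Psharp sh zeta alpha)).
by rewrite mxtrace_mulC.
Qed.

End MGF.

Lemma mgf_root_cvg sh (hM : (0 < M)%N) rho alpha zeta :
  ER HS HE V tau betaref sh -> is_state rho ->
  (fun n : nat =>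
     powR (complex.Re (mgf_sharp HS HE V tau betaref sh hM zeta n rho (cvec alpha))) (n%:R)^-1)
    @ \oo --> rsharp HS HE V tau betaref sh zeta (cvec alpha).
Proof.
move=> hER hrho; have pL := posmap_Ldsharp sh zeta alpha.
have [X [r [pX r0 LX]]] := perron_eigenvector hdS pL (ER_improving zeta alpha hER).
rewrite rsharpE (specrad_perron hdS pL pX r0 LX).
under eq_fun do rewrite mgf_sharpE.
have h := trace_orbit_root_cvg pL pX r0 LX hrho.
exact: h.
Qed.

(** * Symmetry alpha to 1 - alpha under time reversal *)

Section TRI.
Hypothesis hTRI : TRI HS HE V.

(** The deformed map at 1 - alpha and the predual at alpha have the same two Gibbs powers and differ
    only in [mxadj (U k)] against [U k], which time reversal exchanges; the Gibbs powers are
    invariant. *)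
Lemma TRI_intertwine : exists W : 'M[C]_dS, W *m map_mx conjc W = 1%:M /\
  forall alpha zeta k X, anticonj W (Ldj zeta (cvec (fun j => 1 - alpha j)) k X) =
    Pj zeta alpha k (anticonj W X).
Proof.
have [W [WE [[hW invW] [cW hk]]]] := hTRI.
exists W; split; first by apply: antiunitary_involution_mul.
move=> alpha zeta k X; have [[hWE invWE] [cWE cV]] := hk k.
have hWW := unitarymatrix_tens hW hWE.
have aHS := anticommutes_anticonj hW cW.
have aHE := anticommutes_anticonj hWE cWE.
have aV := anticommutes_anticonj hWW cV.
have aH : anticonj (W *t WE k) (Htot HS HE V k) = Htot HS HE V k.
  by rewrite /Htot !anticonjD !anticonj_tens aHS aHE aV !anticonj1.
have sH : selfadjoint (Htot HS HE V k).
  rewrite /Htot; apply: selfadjointD => //; apply: selfadjointD;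
    by apply: selfadjoint_tens => //; apply: selfadjoint1.
have aU : anticonj (W *t WE k) (mxadj (U k)) = U k.
  by rewrite anticonj_adj /Uj (mxfun_anticonj _ hWW sH aH) mxadjK.
rewrite Ldj_Psi (Psi_anticonj _ _ _ _ hW hWE) aU subKr.
by rewrite !(mxpow_gibbs_anticonj _ _ (hdE k) hWE (hHE k) aHE).
Qed.

Lemma specrad_TRI alpha zeta :
  rcy HS HE V tau betaref zeta (cvec (fun j => 1 - alpha j))
    = rrcy HS HE V tau betaref zeta (cvec alpha) /\
  rra HS HE V tau betaref zeta (cvec (fun j => 1 - alpha j))
    = rra HS HE V tau betaref zeta (cvec alpha).
Proof.
have [W [WW hW]] := TRI_intertwine; split.
  (* Conjugation keeps the order of the factors; the trace dual taken afterwards reverses it and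
     yields the reversed cycle. *)
  have -> : rcy HS HE V tau betaref zeta (cvec (fun j => 1 - alpha j)) =
      specrad (fun X => foldr (Pj zeta alpha) X (enum 'I_M)).
    apply: (specrad_anticonj WW) => X; rewrite /Ldcy.
    by elim: (enum 'I_M) => //= k r IHr; rewrite hW IHr.
  apply/esym/specrad_tdual.
  - by have [] := posmap_foldl (enum 'I_M) (posmap_Ldj zeta alpha).
  - by have [] := posmap_foldr (enum 'I_M) (posmap_Pj zeta alpha).
  - apply: tdual_fold => k; apply: tdual_sym; rewrite Ldj_Psi; exact: Psi_dual.
have -> : rra HS HE V tau betaref zeta (cvec (fun j => 1 - alpha j)) =
    specrad (Psharp Ra zeta alpha).
  apply: (specrad_anticonj WW) => X; rewrite /Ldra /Psharp anticonjZ.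
  rewrite conjc_inv conjc_nat; congr (_ *: _).
  elim: (index_enum _) => [|k r IHr]; first by rewrite !big_nil anticonj0.
  by rewrite !big_cons anticonjD hW IHr.
apply: specrad_tdual; last exact: tdual_Psharp.
  by have [] := posmap_Psharp Ra zeta alpha.
by have [] := posmap_Ldsharp Ra zeta alpha.
Qed.

End TRI.

(** * Translation symmetry under the equilibrium condition *)

Section NE.

Lemma ptr_tens d1 d2 (X : 'M[C]_d1) (B : 'M[C]_d2) : ptr (X *t B) = \tr B *: X.
Proof.
apply/matrixP => i j; rewrite !mxE mulrC mulr_sumr.
by apply: eq_bigr => b _; rewrite tensmxE.
Qed.

Lemma Uj_unitary k : unitarymatrix (U k).
Proof.
have sH : selfadjoint (Htot HS HE V k).
  rewrite /Htot; apply: selfadjointD => //; apply: selfadjointD;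
    by apply: selfadjoint_tens => //; apply: selfadjoint1.
have [P [d [hP HE']]] := selfadjoint_udiag sH.
rewrite /Uj HE' (mxfun_udiag _ _ hP); apply: (udiag_unitary hP) => i.
by apply: cexp_unimodular; rewrite /= oppr0 mulr0 mul0r subr0.
Qed.

(** The factor [rp *t G] taken out of the input commutes through [W]; then [rp] leaves the partial
    trace on the right, and [G] moves cyclically to [B'], turning it into [B]. *)
Lemma Psi_commute d1 d2 (W : 'M[C]_(d1 * d2)) (A B A' B' G : 'M[C]_d2) (rp Y : 'M[C]_d1) c :
  (rp *t G) *m W = W *m (rp *t G) -> A' = c *: (A *m G) -> c *: (G *m B') = B ->
  Psi (mxadj W) B' A' (Y *m rp) = Psi (mxadj W) B A Y *m rp.
Proof.
move=> hW hA hB; rewrite /Psi mxadjK.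
have -> : (Y *m rp) *t A' = c *: ((Y *t A) *m (rp *t G)).
  by rewrite hA tensmxZr tensmx_mul.
rewrite -scalemxAr -scalemxAl ptrZ mulmxA -(mulmxA _ _ W) hW.
have -> : rp *t G = (1%:M *t G) *m (rp *t 1%:M) by rewrite tensmx_mul mul1mx mulmx1.
rewrite !mulmxA ptr_mulr -ptr_cyclic scalemxAl -ptrZ !mulmxA tensmx_mul mulmx1.
by rewrite !scalemxAl -tensmxZr hB.
Qed.

Lemma Ldj_NE (rp : 'M[C]_dS) zeta alpha lam k Y : betaj betaref zeta k != 0 ->
  U k *m (rp *t gibbs lam (HE k)) *m mxadj (U k) = rp *t gibbs lam (HE k) ->
  Ldj zeta (cvec (fun j => alpha j + lam * (betaj betaref zeta j)^-1)) k (Y *m rp) =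
  Ldj zeta (cvec alpha) k Y *m rp.
Proof.
move=> b0 hU; set b := betaj betaref zeta k in b0 *.
have comm : (rp *t gibbs lam (HE k)) *m U k = U k *m (rp *t gibbs lam (HE k)).
  move/(congr1 (mulmx^~ (U k))): hU.
  by rewrite -!mulmxA (unitarymatrixV (Uj_unitary k)) mulmx1.
have [P [h [hP HkE]]] := selfadjoint_udiag (hHE k).
rewrite !Ldj_Psi /rhoE /Defs.rhoE -/b.
(* The constant is the ratio between the power lam / b of the Gibbs state at b and the Gibbs state
   at lam: both are multiples of exp(- lam H), with different normalisations. *)
apply: (Psi_commute _ (c := (expR (free_energy lam h - lam / b * free_energy b h))%:C) comm).
  rewrite HkE !(mxpow_gibbs_udiag _ _ _ (hdE k) hP) (gibbs_udiag _ _ (hdE k) hP).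
  rewrite (udiagM _ _ hP) udiagZ; apply: eq_udiag => i.
  by rewrite -!rmorphM -!expRD; congr (expR _)%:C; field.
rewrite HkE !(mxpow_gibbs_udiag _ _ _ (hdE k) hP) (gibbs_udiag _ _ (hdE k) hP).
rewrite (udiagM _ _ hP) udiagZ; apply: eq_udiag => i.
by rewrite -!rmorphM -!expRD; congr (expR _)%:C; field.
Qed.

(** At the constant parameter [z] every collision map fixes [rp], hence so do the composed or
    averaged map and its powers, one of which makes [rp] positive definite. *)
Lemma NE_posdef sh (hM : (0 < M)%N) (rp : 'M[C]_dS) z : ER HS HE V tau betaref sh ->
  is_state rp ->
  (forall k, U k *m (rp *t gibbs (betaref - z) (HE k)) *m mxadj (U k)
     = rp *t gibbs (betaref - z) (HE k)) ->
  posdef rp.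
Proof.
move=> hER [prp trp] hU.
have fixj k : Lj (fun=> z) k rp = rp.
  by rewrite /Lj hU ptr_tens (mxtrace_gibbs _ (hdE k) (hHE k)) scale1r.
have fixL : Lsharp HS HE V tau betaref sh (fun=> z) rp = rp.
  case: sh {hER} => /=.
    by rewrite /Lcy; elim: (enum 'I_M) => //= k r IHr; rewrite fixj.
  rewrite /Lra (eq_bigr (fun=> rp)) // sumr_const card_ord -[rp *+ M]scaler_nat.
  by rewrite scalerA mulVf ?scale1r // pnatr_eq0 -lt0n.
have [p hp] := ER_improving_L (fun=> z) hER.
have itE q : iter q (Lsharp HS HE V tau betaref sh (fun=> z)) rp = rp.
  by elim: q => //= q ->.
rewrite -(itE p); apply: hp => //.
by apply/eqP => e; move: trp; rewrite e mxtrace0 => /esym/eqP; rewrite oner_eq0.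
Qed.

Lemma rsharp_NE sh (hM : (0 < M)%N) alpha zeta lam : ER HS HE V tau betaref sh ->
  NE HS HE V tau betaref -> (forall j, betaj betaref zeta j != 0) ->
  rsharp HS HE V tau betaref sh zeta (cvec alpha) =
  rsharp HS HE V tau betaref sh zeta
    (cvec (fun j => alpha j + lam * (betaj betaref zeta j)^-1)).
Proof.
(* This parameter makes [lam] the inverse temperature of the Gibbs states in (NE). *)
move=> hER [rhop [st inv]] b0; set rp := rhop (betaref - lam).
have hU k : U k *m (rp *t gibbs (betaref - (betaref - lam)) (HE k)) *m mxadj (U k)
    = rp *t gibbs (betaref - (betaref - lam)) (HE k) by exact: inv.
have urp : rp \in unitmx by apply/posdef_unit/(NE_posdef hM hER (st _) hU).
have hj k Y := Ldj_NE alpha Y (b0 k) (etrans (etrans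
  (congr1 (fun b => U k *m (rp *t gibbs b (HE k)) *m mxadj (U k)) (esym (subKr betaref lam)))
  (hU k)) (congr1 (fun b => rp *t gibbs b (HE k)) (subKr betaref lam))).
rewrite !rsharpE; apply: (specrad_similar urp) => X; case: sh {hER} => /=.
  by rewrite /Ldcy; elim: (enum 'I_M) => //= k r IHr; rewrite IHr hj.
rewrite /Ldra -scalemxAl mulmx_suml; congr (_ *: _).
by apply: eq_bigr => k _; exact: hj.
Qed.

End NE.
End MainSteps.

Theorem mainTheorem2 (R : realType) (dS M : nat) (dE : 'I_M -> nat)
  (HS : 'M[R[i]]_dS) (HE : forall j : 'I_M, 'M[R[i]]_(dE j))
  (V : forall j : 'I_M, 'M[R[i]]_(dS * dE j)) (tau : 'I_M -> R) (betaref : R)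
  (hM : (2 <= M)%N) (hdS : (0 < dS)%N) (hdE : forall j, (0 < dE j)%N)
  (hHS : selfadjoint HS) (hHE : forall j, selfadjoint (HE j))
  (hV : forall j, selfadjoint (V j))
  (htau : forall j, 0 < tau j) (hbeta : 0 < betaref) (sh : sharp) :
  ER HS HE V tau betaref sh ->
  (* 1) *)
  (forall rho : 'M[R[i]]_dS, is_state rho -> forall alpha zeta : 'I_M -> R,
     (fun n : nat =>
        powR (complex.Re (mgf_sharp HS HE V tau betaref sh (ltnW hM) zeta n rho
                            (cvec alpha))) (n%:R)^-1)
       @ \oo --> rsharp HS HE V tau betaref sh zeta (cvec alpha))
  /\
  (* 2) *)
  (TRI HS HE V -> forall alpha zeta : 'I_M -> R,
      rcy HS HE V tau betaref zeta (cvec (fun j => 1 - alpha j))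
        = rrcy HS HE V tau betaref zeta (cvec alpha)
   /\ rra HS HE V tau betaref zeta (cvec (fun j => 1 - alpha j))
        = rra HS HE V tau betaref zeta (cvec alpha))
  /\
  (* 3) *)
  (NE HS HE V tau betaref -> forall (alpha zeta : 'I_M -> R) (lam : R),
      (forall j, betaj betaref zeta j != 0) ->
      rsharp HS HE V tau betaref sh zeta (cvec alpha)
        = rsharp HS HE V tau betaref sh zeta
            (cvec (fun j => alpha j + lam * (betaj betaref zeta j)^-1))).
Proof.
move=> hER; split=> [rho hrho alpha zeta|]; first exact: mgf_root_cvg.
split=> [hTRI alpha zeta|hNE alpha zeta lam b0]; first exact: specrad_TRI.
exact: (rsharp_NE hdE hHS hHE hV (ltnW hM)).
Qed.
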